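(* The expected time complexity of the algorithm described below on directed graphs is \[ \widetilde{O}\left(\frac{1}{\varepsilon}\sqrt{\sum_{t\in V}\pi(s,t)\sum_{v\in V}\pi(v,t)d_{\mathrm{in}}(v)}\right). \] Furthermore, this complexity is upper bounded by $\widetilde{O}\big(\sqrt{m}/\varepsilon\big)$.
   Context: Let $G=(V,E)$ be a directed graph with $|V|=n$, $|E|=m$, every node having nonzero out-degree; $d_{\mathrm{in}}(v)$, $d_{\mathrm{out}}(v)$ are in/out-degrees and $\mathcal{N}_{\mathrm{in}}(v)$ the in-neighbors. For a constant decay factor $\alpha\in(0,1)$, an $\alpha$-discounted random walk from $s$ terminates with probability $\alpha$ before each step and otherwise moves to a uniformly random out-neighbor; $\pi(s,t)$ is the probability it terminates at $t$. $\widetilde{O}(\cdot)$ suppresses $\mathrm{polylog}(n)$ factors. Backward Push for target $t$ with threshold $r_{\max}$: initialize reserves $q(v,t)=0$ for all $v$, residues $r(t,t)=1$ and $r(v,t)=0$ otherwise; while some $v$ has $r(v,t)>r_{\max}$, add $(1-\alpha)r(v,t)/d_{\mathrm{out}}(u)$ to $r(u,t)$ for each $u\in\mathcal{N}_{\mathrm{in}}(v)$, add $\alpha r(v,t)$ to $q(v,t)$, and set $r(v,t)=0$. It guarantees $r(v,t)\le r_{\max}$, the invariant $\pi(v,t)=q(v,t)+\sum_{u}\pi(v,u)r(u,t)$, and runs in time $O\big(\frac{1}{r_{\max}}\sum_{v\in V}\pi(v,t)d_{\mathrm{in}}(v)\big)$. Monte Carlo with $k$ walks estimates $\pi(s,v)$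 as the fraction of $k$ independent $\alpha$-discounted walks from $s$ terminating at $v$. The algorithm (given source $s$ and error $\varepsilon$): Phase I runs Monte Carlo with $\lceil 12\ln(2n^3)/\varepsilon\rceil$ walks to get $\pi'(s,v)$ and sets candidate set $C=\{t:\pi'(s,t)>\varepsilon/2\}$. Phase II sets $n_r=\lceil n/\varepsilon\rceil$, $n_t=\lceil 18\ln(2n^2)\rceil$, $r_{\max}(t)=\frac{\varepsilon^2 n_r}{6\pi'(s,t)}$ for $t\in C$; it repeatedly tries Backward Push for every $t\in C$ with threshold $\frac12 r_{\max}(t)$, and if the total cost in this iteration exceeds the expected cost of simulating $n_t\cdot\frac12 n_r$ random walks it stops; otherwise it halves $n_r$ (floor) and all $r_{\max}(t)$ and repeats. After stopping, it runs Backward Push for each $t\in C$ with the current $r_{\max}(t)$. Phase III, repeated $n_t$ times independently, runs Monte Carlo with $n_r$ walks giving $\pi''(s,v)$ and computes $\hat\pi_i(s,t)=q(s,t)+\sum_{v}\pi''(s,v)r(v,t)$ for $t\in C$; the output is the median over $i$ for $t\in C$ and $0$ for $t\notin C$. With probability at least $1-1/n^2$ Phase I succeeds, in which case all $t\in C$ satisfy $\frac12\pi(s,t)\le\pi'(s,t)\le\frac32\pi(s,t)$. It is claimed (and proved) that this doubling/stopping scheme achieves, up to constants, the cost obtained with the optimal $n_r$ balancing Phases II and III. To handle Phase I failure, the algorithm switches to the Power Method once its cost reaches $\Theta(n^2)$. *)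

(* Defs.v *)
From HB Require Import structures.
From mathcomp Require Import all_boot all_order all_algebra.
From mathcomp Require Import all_classical all_reals all_analysis.

Set Implicit Arguments.
Unset Strict Implicit.
Unset Printing Implicit Defensive.

Import Order.TTheory GRing.Theory Num.Theory.

Local Open Scope ring_scope.

Definition natceil (R : realType) (x : R) : nat := `|Num.ceil x|%N.

Definition median (R : realType) (xs : seq R) : R :=
  nth 0 (sort <=%R xs) (size xs)./2.

(* The first round at which the exit test of a loop holds; the value 0 for a
   loop that never exits is a dummy. *)
Definition loop_exit (P : pred nat) : nat :=
  if pselect (exists j, P j) is left ex_j then ex_minn ex_j else 0.

Section DiscreteProbability.
Variables (R : realType) (T : choiceType).

Definition expect (p : T -> R) (f : T -> \bar R) : \bar R :=
  \esum_(x in [set: T]%classic) ((p x)%:E * f x)%E.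

Definition iid_pr (p : T -> R) (k : nat) (xs : k.-tuple T) : R :=
  \prod_(x <- xs) p x.

End DiscreteProbability.

Section Graph.
Variables (R : realType) (alpha : R) (V : finType) (e : rel V).

Definition din (v : V) : nat := #|[pred u | e u v]|.
Definition dout (v : V) : nat := #|[pred w | e v w]|.
Definition nnodes : nat := #|V|.
Definition nedges : nat := #|[pred uv : V * V | e uv.1 uv.2]|.

(* A terminated walk from s is encoded by the sequence w of the nodes visited
   after s: it has size w steps and it terminates at last s w. *)
Fixpoint walk_pr (s : V) (w : seq V) : R :=
  if w is v :: w' then
    (1 - alpha) * (if e s v then (dout s)%:R^-1 else 0) * walk_pr v w'
  else alpha.

Definition ppr (s t : V) : R :=
  fine (\esum_(w in [set w | last s w = t]%classic) (walk_pr s w)%:E).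

(* One unit for each termination test, i.e. for each node visited. *)
Definition walk_cost (w : seq V) : nat := (size w).+1.

Definition mean_walk_cost (s : V) : R :=
  fine (expect (walk_pr s) (fun w => (walk_cost w)%:R%:E)).

Definition monte_carlo (s : V) (ws : seq (seq V)) (v : V) : R :=
  (count [pred w | last s w == v] ws)%:R / (size ws)%:R.

Definition monte_carlo_cost (ws : seq (seq V)) : nat :=
  (\sum_(w <- ws) walk_cost w)%N.

Section BackwardPush.

Record bp_state := BPState { reserve : V -> R ; residue : V -> R }.

Definition bp_init (t : V) : bp_state :=
  BPState (fun=> 0) (fun v => if v == t then 1 else 0).

(* At a self-loop, the mass pushed from v to v itself is kept, as the
   invariant of Backward Push requires. *)
Definition push (v : V) (st : bp_state) : bp_state :=
  BPState
    (fun u => reserve st u + if u == v then alpha * residue st v else 0)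
    (fun u => (if u == v then 0 else residue st u) +
       if e u v then (1 - alpha) * residue st v / (dout u)%:R else 0).

(* The state reached after pushing the nodes of h, most recent first. *)
Definition bp_run (t : V) (h : seq V) : bp_state := foldr push (bp_init t) h.

Definition bp_active (t : V) (thr : R) (h : seq V) : bool :=
  [exists v, thr < residue (bp_run t h) v].

(* A deterministic choice of the next node to push, from the target, the
   threshold and the nodes pushed so far (hence also from the state). *)
Definition push_rule := V -> R -> seq V -> V.

Definition valid_rule (rule : push_rule) : Prop :=
  forall t thr h, bp_active t thr h ->
    thr < residue (bp_run t h) (rule t thr h).

Variable rule : push_rule.

Definition bp_rounds (t : V) (thr : R) (k : nat) : seq V :=
  iter k (fun h => rule t thr h :: h) [::].

Definition bp_history (t : V) (thr : R) : seq V :=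
  bp_rounds t thr (loop_exit (fun k => ~~ bp_active t thr (bp_rounds t thr k))).

Definition backward_push (t : V) (thr : R) : bp_state :=
  bp_run t (bp_history t thr).

(* One unit for the initialization and, for each push on v, one unit for v and
   one for each of its in-neighbors. *)
Definition backward_push_cost (t : V) (thr : R) : nat :=
  (1 + \sum_(v <- bp_history t thr) (1 + din v))%N.

End BackwardPush.

Section PowerMethod.
Variables (s : V) (eps : R).

Definition transition (x : V -> R) (v : V) : R :=
  \sum_(u | e u v) x u / (dout u)%:R.

(* The least number of terms after which the neglected mass
   (1 - alpha) ^+ power_iters is at most eps. *)
Definition power_iters : nat := natceil (ln eps / ln (1 - alpha)).

Definition power_method (t : V) : R :=
  \sum_(i < power_iters) alpha * (1 - alpha) ^+ i *
    iter i transition (fun v => if v == s then 1 else 0) t.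

Definition power_method_cost : nat := (power_iters * (nnodes + nedges))%N.

End PowerMethod.

Section Algorithm.
Variables (rule : push_rule) (s : V) (eps : R).

Local Notation n := nnodes%:R.

Definition phase1_walks : nat := natceil (12 * ln (2 * n ^+ 3) / eps).
Definition n_t : nat := @natceil R (18 * ln (2 * n ^+ 2)).

Section PhaseTwo.
Variable ws : phase1_walks.-tuple (seq V).

Definition pi1 : V -> R := monte_carlo s ws.

Definition candidates : pred V := [pred t | eps / 2 < pi1 t].

Definition n_r (j : nat) : nat := iter j half (natceil (n / eps)).

Definition r_max (j : nat) (t : V) : R :=
  eps ^+ 2 * (natceil (n / eps))%:R / (6 * pi1 t) / 2 ^+ j.

Definition trial_full_cost (j : nat) : nat :=
  (1 + \sum_(t | candidates t) backward_push_cost rule t (r_max j t / 2))%N.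

Definition trial_budget (j : nat) : R :=
  n_t%:R * ((n_r j)%:R / 2) * mean_walk_cost s.

Definition trial_exceeds (j : nat) : bool :=
  trial_budget j < (trial_full_cost j)%:R.

(* A trial is interrupted at the first unit of cost above its budget. *)
Definition trial_cost (j : nat) : nat :=
  if trial_exceeds j then (Num.truncn (trial_budget j)).+1
  else trial_full_cost j.

(* The number of halvings performed before stopping. *)
Definition halvings : nat := loop_exit trial_exceeds.

Definition phase3_walks : nat := n_r halvings.

Definition pushed (t : V) : bp_state :=
  backward_push rule t (r_max halvings t).

Definition phase2_cost : nat :=
  (\sum_(j < halvings.+1) trial_cost j +
   \sum_(t | candidates t) backward_push_cost rule t (r_max halvings t))%N.

Definition estimate (xs : seq (seq V)) (t : V) : R :=
  reserve (pushed t) s + \sum_v monte_carlo s xs v * residue (pushed t) v.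

(* The sum over v in an estimate is evaluated on the nonzero residues; the extra
   unit per candidate and per batch also pays for selecting the median in
   linear time. *)
Definition estimates_cost : nat :=
  (\sum_(t | candidates t) (1 + #|[pred v | residue (pushed t) v != 0%R]|))%N.

Definition phase3_cost (yss : n_t.-tuple (phase3_walks.-tuple (seq V))) : nat :=
  (\sum_(ys <- yss) (monte_carlo_cost ys + estimates_cost))%N.

Definition phase3_output (yss : n_t.-tuple (phase3_walks.-tuple (seq V)))
    (t : V) : R :=
  if candidates t then
    median [seq estimate (ys : phase3_walks.-tuple (seq V)) t | ys <- yss]
  else 0.

Record outcome := Outcome { output : V -> R ; cost : R }.

(* The run on given random walks; it switches to the Power Method as soon as
   its cost reaches cap. *)
Definition algorithm (cap : R)
    (yss : n_t.-tuple (phase3_walks.-tuple (seq V))) : outcome :=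
  let c := (monte_carlo_cost ws + phase2_cost + phase3_cost yss)%:R in
  if c < cap then Outcome (phase3_output yss) c
  else Outcome (power_method s eps) (cap + (power_method_cost eps)%:R).

End PhaseTwo.

(* The walks of the first phase are independent; given them, the n_t batches of
   walks of the third phase, whose size they determine, are independent. *)
Definition expected_time (cap : R) : \bar R :=
  expect (iid_pr (walk_pr s) (k := phase1_walks)) (fun ws =>
    expect (iid_pr (iid_pr (walk_pr s) (k := phase3_walks ws)) (k := n_t))
      (fun yss => (cost (algorithm cap yss))%:E)).

Definition push_weight : R :=
  \sum_(t : V) ppr s t * \sum_(v : V) ppr v t * (din v)%:R.

End Algorithm.

Definition polylog (k : nat) : R := (1 + ln nnodes%:R) ^+ k.

End Graph.

(* Main.v *)
Require Import Defs.
From mathcomp Require Import all_boot all_order all_algebra finmap.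
From mathcomp Require Import all_classical all_reals all_analysis.
From mathcomp Require Import ring lra.

Set Implicit Arguments.
Unset Strict Implicit.
Unset Printing Implicit Defensive.

Import Order.TTheory GRing.Theory Num.Theory.
Local Open Scope ring_scope.

(* Put X = sqrt (push_weight) / eps.  If every candidate t satisfies
   pi' (s, t) <= 4 pi (s, t), then one round of pushes with parameter n_r costs
   O(1 / eps + X ^ 2 / n_r), while its budget is proportional to n_t n_r.  Hence a
   round with n_r >= X costs O(X), and a completed round with n_r < X costs at most
   its budget, O(n_t X); the first round over budget has n_r = O(X).  So each of the
   O(log (n / eps)) rounds, and the third phase, cost O(X) up to logarithms.  As
   push_weight >= alpha ^ 2 (1 - alpha), the terms O(1 / eps) are also O(X).

   The condition on the candidates fails with probability at most 1 / n ^ 2, by a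
   Chernoff bound, and the cap then limits the cost to O(n ^ 2 log (1 / eps)).  The
   factors log (1 / eps) are O(log n) if eps > 1 / n ^ 3; otherwise the cap alone
   gives a cost of O(1 / eps).  Finally push_weight <= m because the sum over t of
   pi (s, t) pi (v, t) is at most 1. *)

(** * Sums of nonnegative extended reals over words and tuples *)

Section Esum.
Local Open Scope ereal_scope.
Variable R : realType.

Lemma esumZl (T : choiceType) (I : set T) (c : R) (a : T -> \bar R) :
  (0 <= c)%R -> (forall i, 0 <= a i) ->
  \esum_(i in I) (c%:E * a i) = c%:E * \esum_(i in I) a i.
Proof.
move=> c0 a0; rewrite /esum -ereal_supZl//; last first.
  by apply/set0P; exists (\sum_(x \in set0) a x), set0 => //; exact: fsets_set0.
congr ereal_sup; apply/seteqP; split => [_ [X [fX XI] <-]|_ [_ [X [fX XI] <-] <-]].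
  by exists (\sum_(x \in X) a x); [exists X | rewrite ge0_mule_fsumr].
by exists X => //; rewrite ge0_mule_fsumr.
Qed.

Lemma esum_finType (T : finType) (a : T -> \bar R) :
  (forall i, 0 <= a i) -> \esum_(i in [set: T]) a i = \sum_i a i.
Proof.
move=> a0; rewrite esum_fset//; last exact: finite_finset.
rewrite [RHS]fsbig_seq ?index_enum_uniq//; apply: eq_fsbigl.
by apply/seteqP; split => // x _ /=; rewrite mem_index_enum.
Qed.

(** Splitting a word at its first letter is what turns expectations over walks into one-step
    recursions. *)
Lemma esum_seq (T : finType) (f : seq T -> \bar R) :
  (forall w, 0 <= f w) ->
  \esum_(w in [set: seq T]) f w =
    f [::] + \sum_(v : T) \esum_(w in [set: seq T]) f (v :: w).
Proof.
move=> f0; rewrite (esumID [set [::]])// setTI esum_set1// setTI; congr (_ + _).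
rewrite -esum_finType; last by move=> v; exact: esum_ge0.
rewrite esum_esum//.
apply: (reindex_esum _ _ (fun vw => vw.1 :: vw.2)); split => //=.
- by move=> [v w] [w1 w2] _ _ /= [-> ->].
- by move=> [/(_ erefl)//|v w _]; exists (v, w).
Qed.

Lemma esum_tuple0 (T : choiceType) (f : 0.-tuple T -> \bar R) :
  (forall w, 0 <= f w) -> \esum_(w in [set: 0.-tuple T]) f w = f [tuple].
Proof.
move=> f0; rewrite -[RHS]esum_set1//; congr esum.
by apply/seteqP; split => x //= _; rewrite (tuple0 x).
Qed.

Lemma esum_tupleS (T : choiceType) (k : nat) (f : k.+1.-tuple T -> \bar R) :
  (forall w, 0 <= f w) ->
  \esum_(w in [set: k.+1.-tuple T]) f w =
  \esum_(x in [set: T]) \esum_(w in [set: k.-tuple T]) f [tuple of x :: w].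
Proof.
move=> f0; rewrite esum_esum//.
apply: (reindex_esum _ _ (fun xw : T * k.-tuple T => [tuple of xw.1 :: xw.2])); split => //=.
- move=> [v w] [w1 w2] _ _ /= /(congr1 val)/= [-> ww]; congr pair.
  exact: val_inj.
- by move=> w _; exists (thead w, [tuple of behead w]); rewrite //= [RHS]tuple_eta.
Qed.

End Esum.

(** * Expectations under a weight of total mass at most 1 *)

Section Expect.
Local Open Scope ereal_scope.
Variables (R : realType) (T : choiceType) (p : T -> R).
Hypothesis p0 : forall x, (0 <= p x)%R.
Implicit Types f g : T -> \bar R.

Lemma expect_ge0 f : (forall x, 0 <= f x) -> 0 <= expect p f.
Proof. by move=> f0; apply: esum_ge0 => x _; rewrite mule_ge0// lee_fin. Qed.

Lemma le_expect f g : (forall x, f x <= g x) -> expect p f <= expect p g.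
Proof. by move=> fg; apply: le_esum => x _; rewrite lee_wpmul2l// lee_fin. Qed.

Lemma eq_expect f g : (forall x, f x = g x) -> expect p f = expect p g.
Proof. by move=> fg; apply: eq_esum => x _; rewrite fg. Qed.

Lemma expectD f g : (forall x, 0 <= f x) -> (forall x, 0 <= g x) ->
  expect p (fun x => f x + g x) = expect p f + expect p g.
Proof.
move=> f0 g0; rewrite /expect -esumD; last 2 first.
- by move=> x _; rewrite mule_ge0// lee_fin.
- by move=> x _; rewrite mule_ge0// lee_fin.
by apply: eq_esum => x _; rewrite ge0_muleDr.
Qed.

Lemma expectZ (c : R) f : (0 <= c)%R -> (forall x, 0 <= f x) ->
  expect p (fun x => c%:E * f x) = c%:E * expect p f.
Proof.
move=> c0 f0; rewrite /expect -esumZl//; last first.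
  by move=> x; rewrite mule_ge0// lee_fin.
by apply: eq_esum => x _; rewrite muleCA.
Qed.

Lemma expect_sum (I : choiceType) (r : seq I) (f : I -> T -> \bar R) :
  (forall i x, 0 <= f i x) ->
  expect p (fun x => \sum_(i <- r) f i x) = \sum_(i <- r) expect p (f i).
Proof.
move=> f0; rewrite /expect -esum_sum; last first.
  by move=> x i _ _; rewrite mule_ge0// lee_fin.
by apply: eq_esum => x _; rewrite ge0_sume_distrr.
Qed.

Hypothesis p1 : expect p (cst 1) <= 1.

(** Mass at most 1 suffices for upper bounds on expected costs, so the almost sure termination of
    walks never has to be established. *)
Lemma expect_cst_le (c : R) : (0 <= c)%R -> expect p (cst c%:E) <= c%:E.
Proof.
move=> c0; rewrite (@eq_expect _ (fun x => c%:E * (cst 1) x)); last first.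
  by move=> x; rewrite mule1.
by rewrite expectZ// -[leRHS]mule1 lee_wpmul2l// lee_fin.
Qed.

End Expect.

(** * Independent samples *)

Section ExpectIid.
Local Open Scope ereal_scope.
Variables (R : realType) (T : choiceType) (p : T -> R).
Hypothesis p0 : forall x, (0 <= p x)%R.

Lemma iid_pr_ge0 (k : nat) (xs : k.-tuple T) : (0 <= iid_pr p xs)%R.
Proof. by rewrite /iid_pr prodr_ge0. Qed.

Lemma expect_iid0 (F : 0.-tuple T -> \bar R) :
  (forall xs, 0 <= F xs) -> expect (iid_pr p (k := 0)) F = F [tuple].
Proof.
move=> F0; rewrite /expect esum_tuple0; last first.
  by move=> xs; rewrite mule_ge0// lee_fin iid_pr_ge0.
by rewrite /iid_pr big_nil mul1e.
Qed.

Lemma expect_iidS (k : nat) (F : k.+1.-tuple T -> \bar R) :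
  (forall xs, 0 <= F xs) ->
  expect (iid_pr p (k := k.+1)) F =
  expect p (fun x => expect (iid_pr p (k := k)) (fun xs => F [tuple of x :: xs])).
Proof.
move=> F0; rewrite /expect esum_tupleS; last first.
  by move=> xs; rewrite mule_ge0// lee_fin iid_pr_ge0.
apply: eq_esum => x _; rewrite -esumZl//; last first.
  by move=> xs; rewrite mule_ge0// lee_fin iid_pr_ge0.
by apply: eq_esum => xs _; rewrite /iid_pr big_cons EFinM muleA.
Qed.

Hypothesis p1 : expect p (cst 1) <= 1.

Lemma expect_iid_cst1 (k : nat) : expect (iid_pr p (k := k)) (cst 1) <= 1.
Proof.
elim: k => [|k IH]; first by rewrite expect_iid0.
rewrite expect_iidS//; apply: le_trans p1; exact: le_expect.
Qed.

Lemma expect_iid_sum (k : nat) (g : T -> R) (mu : R) :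
  (forall x, 0 <= g x)%R -> (0 <= mu)%R ->
  expect p (fun x => (g x)%:E) <= mu%:E ->
  expect (iid_pr p (k := k)) (fun xs => (\sum_(x <- xs) g x)%:E) <=
    (k%:R * mu)%:E.
Proof.
move=> g0 mu0 gmu; elim: k => [|k IH].
  rewrite expect_iid0 ?big_nil ?mul0r// => xs.
  by rewrite lee_fin sumr_ge0.
have S0 j (xs : j.-tuple T) : (0 <= \sum_(x <- xs) g x)%R by rewrite sumr_ge0.
rewrite expect_iidS//; last by move=> xs; rewrite lee_fin.
apply: (@le_trans _ _ (expect p (fun x => (g x)%:E + (k%:R * mu)%:E))).
  apply: le_expect => // x.
  rewrite (@eq_expect _ _ _ _ (fun xs : k.-tuple T =>
      (cst (g x)%:E) xs + (\sum_(x <- xs) g x)%:E)); last first.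
    by move=> xs /=; rewrite big_cons EFinD.
  rewrite expectD/=; last 3 first.
  - exact: iid_pr_ge0.
  - by move=> xs; rewrite lee_fin.
  - by move=> xs; rewrite lee_fin.
  rewrite leeD//; apply: expect_cst_le => //; first exact: iid_pr_ge0.
  exact: expect_iid_cst1.
rewrite expectD//; last by move=> x; rewrite lee_fin mulr_ge0.
rewrite -natr1 mulrDl mul1r addrC EFinD leeD//.
by apply: expect_cst_le => //; rewrite mulr_ge0.
Qed.

(** Independence lets the factors be integrated out one at a time; this is the exponential-moment
    part of the Chernoff bound. *)
Lemma expect_iid_prod (k : nat) (g : T -> R) :
  (forall x, 0 <= g x)%R -> expect p (fun x => (g x)%:E) <= 1 ->
  expect (iid_pr p (k := k)) (fun xs => (\prod_(x <- xs) g x)%:E) <= 1.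
Proof.
move=> g0 g1; elim: k => [|k IH].
  rewrite expect_iid0 ?big_nil// => xs.
  by rewrite lee_fin prodr_ge0.
have S0 j (xs : j.-tuple T) : (0 <= \prod_(x <- xs) g x)%R by rewrite prodr_ge0.
rewrite expect_iidS//; last by move=> xs; rewrite lee_fin.
apply: le_trans g1.
apply: le_expect => // x.
rewrite (@eq_expect _ _ _ _ (fun xs : k.-tuple T =>
    (g x)%:E * (\prod_(x <- xs) g x)%:E)); last first.
  by move=> xs; rewrite big_cons EFinM.
rewrite expectZ//; last 2 first.
- exact: iid_pr_ge0.
- by move=> xs; rewrite lee_fin.
by rewrite -[leRHS]mule1 lee_wpmul2l// lee_fin.
Qed.

End ExpectIid.

(** * Discounted walks, PageRank values and the push weight *)

Section Walks.
Variables (R : realType) (alpha : R) (V : finType) (e : rel V).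
Hypothesis alpha01 : 0 < alpha < 1.
Hypothesis dout_gt0 : forall v, (0 < dout e v)%N.
Implicit Types (s t u v : V) (w : seq V).

Local Notation walk := (walk_pr alpha e).
Local Notation pi := (ppr alpha e).

Definition step_pr u v : R := (1 - alpha) * (if e u v then (dout e u)%:R^-1 else 0).

Let alpha_gt0 : 0 < alpha. Proof. by case/andP: alpha01. Qed.
Let alpha_lt1 : 0 < 1 - alpha. Proof. by rewrite subr_gt0; case/andP: alpha01. Qed.

Lemma step_pr_ge0 u v : 0 <= step_pr u v.
Proof. by rewrite mulr_ge0 ?(ltW alpha_lt1)//; case: ifP. Qed.

Lemma sum_step_pr u : \sum_v step_pr u v = 1 - alpha.
Proof.
rewrite -mulr_sumr -big_mkcond/= sumr_const -[X in _ *+ X]/(dout e u).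
by rewrite -[X in _ * X]mulr_natr mulVf ?mulr1// pnatr_eq0 -lt0n dout_gt0.
Qed.

Lemma walk_pr_ge0 s w : 0 <= walk s w.
Proof.
elim: w s => [|v w IH] s /=; first exact: ltW.
by rewrite mulr_ge0//; exact: step_pr_ge0.
Qed.

Lemma expect_walk s (f : seq V -> \bar R) : (forall w, 0 <= f w)%E ->
  expect (walk s) f = (alpha%:E * f [::] + \sum_v (step_pr s v)%:E *
    expect (walk v) (fun w => f (v :: w)))%E.
Proof.
move=> f0; rewrite /expect esum_seq; last first.
  by move=> w; rewrite mule_ge0// lee_fin walk_pr_ge0.
congr (_ + _)%E; apply: eq_bigr => v _.
rewrite -esumZl ?step_pr_ge0//; last first.
  by move=> w; rewrite mule_ge0// lee_fin walk_pr_ge0.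
by apply: eq_esum => w _; rewrite /= EFinM muleA.
Qed.

Lemma expect_walk_le s (f : seq V -> \bar R) (b : R) (B : V -> R) :
  (forall w, 0 <= f w)%E -> (f [::] <= b%:E)%E ->
  (forall v, expect (walk v) (fun w => f (v :: w)) <= (B v)%:E)%E ->
  (expect (walk s) f <= (alpha * b + \sum_v step_pr s v * B v)%:E)%E.
Proof.
move=> f0 fb fB; rewrite expect_walk// EFinD EFinM -sumEFin leeD//.
  by rewrite lee_wpmul2l// lee_fin ltW.
by apply: lee_sum => v _; rewrite [leRHS]EFinM lee_wpmul2l// lee_fin step_pr_ge0.
Qed.

(** An infinite sum is a supremum over finite sets of words, and each such set has bounded length;
    this licenses induction on the length of walks. *)
Lemma esum_le_size (a : seq V -> \bar R) (B : \bar R) :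
  (forall N, \esum_(w in [set: seq V]) (if (size w < N)%N then a w else 0) <= B)%E ->
  (\esum_(w in [set: seq V]) a w <= B)%E.
Proof.
move=> aB; apply: ge_ereal_sup => _ [X [fX _] <-].
pose N := (\max_(w <- fset_set X) size w)%N.
apply: (le_trans _ (aB N.+1)).
apply: esum_ge; exists X => //; rewrite !fsbig_finite//= big_seq [leRHS]big_seq.
by apply: lee_sum => w wX; rewrite ifT// ltnS; exact: leq_bigmax_seq.
Qed.

Lemma expect_walk_le_size s (f : seq V -> R) (B : R) :
  (forall w, 0 <= f w) ->
  (forall N, expect (walk s) (fun w => (if (size w < N)%N then f w else 0)%:E) <= B%:E)%E ->
  (expect (walk s) (fun w => (f w)%:E) <= B%:E)%E.
Proof.
move=> f0 fB; apply: esum_le_size => N; apply: le_trans (fB N).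
by apply: le_esum => w _; case: ifP; rewrite ?mule0.
Qed.

Lemma expect_walk_cst1 s : (expect (walk s) (cst 1) <= 1)%E.
Proof.
apply: (@expect_walk_le_size _ (fun=> 1)) => // N.
elim: N s => [|N IH] s.
  rewrite /= /expect esum1 ?lee_fin// => w _; exact: mule0.
apply: le_trans (@expect_walk_le _ _ 1 (fun=> 1) _ _ _) _ => //.
- by move=> w; case: ifP; rewrite lee_fin.
- by rewrite /= -mulr_suml sum_step_pr lee_fin; lra.
Qed.

Lemma expect_walk_cost s :
  (expect (walk s) (fun w => (walk_cost w)%:R%:E) <= alpha^-1%:E)%E.
Proof.
apply: (@expect_walk_le_size _ (fun w => (walk_cost w)%:R)) => // N.
elim: N s => [|N IH] s.
  rewrite /= /expect esum1 ?lee_fin ?invr_ge0 ?(ltW alpha_gt0)// => w _.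
  exact: mule0.
(* A nonempty walk costs one unit more than its tail, and [alpha^-1] solves
   [x = alpha + (1 - alpha) * (x + 1)]. *)
apply: le_trans (@expect_walk_le _ _ 1 (fun=> alpha^-1 + 1) _ _ _) _ => //.
- by move=> w; case: ifP; rewrite lee_fin.
- move=> v; rewrite EFinD.
  apply: le_trans (leeD (IH v) (expect_walk_cst1 v)).
  rewrite -expectD//; last 2 first.
  + exact: walk_pr_ge0.
  + by move=> w; case: ifP; rewrite lee_fin.
  apply: le_expect => [|w]; first exact: walk_pr_ge0.
  rewrite /= ltnS /walk_cost; case: ifP => _; last by rewrite add0e.
  by rewrite -EFinD lee_fin /= natr1.
- rewrite /= -mulr_suml sum_step_pr lee_fin mulr1 mulrDr mulr1 mulrBl mul1r mulfV ?gt_eqF//.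
  by lra.
Qed.

(** The lower bound comes from the walk that stops at once, of probability [alpha] and cost 1.
    Finiteness of the expectation ensures that [fine] does not return its default value. *)
Lemma mean_walk_cost_bounds s : alpha <= mean_walk_cost alpha e s <= alpha^-1.
Proof.
have c0 w : (0 <= (walk_cost w)%:R%:E :> \bar R)%E by rewrite lee_fin.
have ge_a : (alpha%:E <= expect (walk s) (fun w => (walk_cost w)%:R%:E))%E.
  rewrite expect_walk// mule1 leeDl//; apply: sume_ge0 => v _.
  rewrite mule_ge0 ?lee_fin ?step_pr_ge0// expect_ge0//; exact: walk_pr_ge0.
have fin : expect (walk s) (fun w => (walk_cost w)%:R%:E) \is a fin_num.
  rewrite ge0_fin_numE; first exact: le_lt_trans (expect_walk_cost s) (ltry _).
  by apply: le_trans ge_a; rewrite lee_fin ltW.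
by rewrite -!lee_fin fineK// ge_a expect_walk_cost.
Qed.

(** The defining sum is at most the total mass, hence finite, so [fine] loses nothing; as an
    expectation it obeys the one-step recursion. *)
Lemma pprE s t :
  (pi s t)%:E = expect (walk s) (fun w => (last s w == t)%:R%:E).
Proof.
have -> : expect (walk s) (fun w => (last s w == t)%:R%:E) =
    \esum_(w in [set w | last s w = t]%classic) (walk s w)%:E.
  rewrite [RHS]esum_mkcond; apply: eq_esum => w _.
  case: ifPn => [|/negP]; rewrite inE/=; first by move=> ->; rewrite eqxx mule1.
  by move=> /eqP/negPf ->; rewrite mule0.
rewrite /ppr fineK// ge0_fin_numE; last first.
  by apply: esum_ge0 => w _; rewrite lee_fin walk_pr_ge0.
apply: le_lt_trans (ltry 1); apply: le_trans (expect_walk_cst1 s).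
rewrite esum_mkcond; apply: le_esum => w _; case: ifP => _; rewrite mule1//.
by rewrite lee_fin walk_pr_ge0.
Qed.

Lemma ppr_ge0 s t : 0 <= pi s t.
Proof.
by rewrite -lee_fin pprE expect_ge0//; exact: walk_pr_ge0.
Qed.

Lemma ppr_rec s t : pi s t = alpha * (s == t)%:R + \sum_v step_pr s v * pi v t.
Proof.
apply: EFin_inj; rewrite pprE expect_walk; last by move=> w; rewrite lee_fin.
rewrite EFinD EFinM -sumEFin; congr (_ + _)%E.
by apply: eq_bigr => v _; rewrite [RHS]EFinM pprE.
Qed.

Lemma sum_ppr_le1 s : \sum_t pi s t <= 1.
Proof.
rewrite -lee_fin -sumEFin.
under eq_bigr do rewrite pprE.
rewrite -expect_sum; last 2 first.
- exact: walk_pr_ge0.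
- by move=> i w; rewrite lee_fin.
apply: le_trans (expect_walk_cst1 s); apply: le_expect => [|w].
  exact: walk_pr_ge0.
rewrite (bigD1 (last s w))//= eqxx big1 ?adde0// => v; rewrite eq_sym.
by move/negPf ->.
Qed.

Lemma ppr_le1 s t : pi s t <= 1.
Proof.
apply: le_trans (sum_ppr_le1 s); rewrite (bigD1 t)//= lerDl sumr_ge0// => v _.
exact: ppr_ge0.
Qed.

Lemma ppr_ge_alpha t : alpha <= pi t t.
Proof.
rewrite ppr_rec eqxx mulr1 lerDl sumr_ge0// => v _.
by rewrite mulr_ge0 ?step_pr_ge0 ?ppr_ge0.
Qed.

Lemma ppr_ge_step s t : step_pr s t * alpha <= pi s t.
Proof.
rewrite ppr_rec (bigD1 t)//= addrCA -[leLHS]addr0 lerD//.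
  by rewrite ler_wpM2l ?step_pr_ge0 ?ppr_ge_alpha.
rewrite addr_ge0 ?mulr_ge0 ?(ltW alpha_gt0)// sumr_ge0// => v _.
by rewrite mulr_ge0 ?step_pr_ge0 ?ppr_ge0.
Qed.

Lemma sum_ppr_din_ge0 t : 0 <= \sum_v pi v t * (din e v)%:R.
Proof. by rewrite sumr_ge0// => v _; rewrite mulr_ge0 ?ppr_ge0. Qed.

(* Expanding pi v t by one step charges pi w t at most once to each edge v -> w. *)
Lemma sum_ppr_target_le t : \sum_v pi v t <= 1 + \sum_v pi v t * (din e v)%:R.
Proof.
under eq_bigr do rewrite ppr_rec.
rewrite big_split/= lerD//.
  rewrite (bigD1 t)//= eqxx big1 ?addr0 ?mulr1; first by rewrite ltW//; case/andP: alpha01.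
  by move=> v /negPf ->; rewrite mulr0.
rewrite exchange_big/=; apply: ler_sum => v _.
rewrite -mulr_suml mulrC ler_wpM2l ?ppr_ge0// /din -sum1_card natr_sum/=.
rewrite [leRHS]big_mkcond/=; apply: ler_sum => u _.
rewrite /step_pr inE; case: ifP => _; last by rewrite mulr0.
apply: (@le_trans _ _ (1 * 1)); last by rewrite mulr1.
rewrite ler_pM ?invr_ge0 ?(ltW alpha_lt1)//; first by rewrite gerBl ltW.
by rewrite invf_le1 ?ltr0n ?dout_gt0// ler1n dout_gt0.
Qed.

(** Only out-neighbors [t] of [s] and the inner term [v = t] are kept: there [din t] is at least 1
    because of the edge from [s], and the step probabilities sum to [1 - alpha]. The bound lets
    additive constants be absorbed into the final estimate. *)
Lemma push_weight_ge s : alpha ^+ 2 * (1 - alpha) <= push_weight alpha e s.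
Proof.
rewrite -(sum_step_pr s) mulr_sumr; apply: ler_sum => t _.
case est : (e s t); last first.
  by rewrite /step_pr est !mulr0 mulr_ge0 ?ppr_ge0 ?sum_ppr_din_ge0.
have -> : alpha ^+ 2 * step_pr s t = step_pr s t * alpha * alpha by ring.
apply: ler_pM; [|exact: ltW|exact: ppr_ge_step|].
  by rewrite mulr_ge0 ?step_pr_ge0 ?(ltW alpha_gt0).
rewrite (bigD1 t)//= -[leLHS]addr0 lerD//.
  rewrite -[leLHS]mulr1 ler_pM ?(ltW alpha_gt0) ?ppr_ge_alpha//.
  by rewrite ler1n; apply/card_gt0P; exists s.
by rewrite sumr_ge0// => v _; rewrite mulr_ge0 ?ppr_ge0.
Qed.

Lemma nedges_sum_din : nedges e = (\sum_v din e v)%N.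
Proof.
rewrite /nedges -sum1_card; under [RHS]eq_bigr do rewrite /din -sum1_card.
rewrite (exchange_big_dep predT)//= pair_big_dep/=.
by apply: eq_bigl => -[u v].
Qed.

Lemma push_weight_le s : push_weight alpha e s <= (nedges e)%:R.
Proof.
rewrite nedges_sum_din natr_sum.
apply: (@le_trans _ _ (\sum_v (\sum_t pi v t) * (din e v)%:R)).
  rewrite (eq_bigr (fun v => \sum_t pi v t * (din e v)%:R)); last first.
    by move=> v _; rewrite mulr_suml.
  rewrite exchange_big/=; apply: ler_sum => t _.
  by rewrite ler_piMl ?sum_ppr_din_ge0 ?ppr_le1.
by apply: ler_sum => v _; rewrite ler_piMl ?sum_ppr_le1.
Qed.

Lemma nedges_le : (nedges e <= nnodes V ^ 2)%N.
Proof. by rewrite /nedges (leq_trans (max_card _))// card_prod mulnn. Qed.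

End Walks.

(** If the test never succeeds, the exit is the dummy 0 and no [k] lies below it. *)
Lemma loop_exit_lt (P : pred nat) (k : nat) : (k < loop_exit P)%N -> ~~ P k.
Proof.
rewrite /loop_exit; case: pselect => [ex_j|//]; case: ex_minnP => m _ mP km.
by apply/negP => /mP; rewrite leqNgt km.
Qed.

Lemma loop_exitP (P : pred nat) : (exists j, P j) -> P (loop_exit P).
Proof. by rewrite /loop_exit; case: pselect => // ex_j _; case: ex_minnP. Qed.

(** * Backward Push: invariant and cost *)

Section BackwardPushCost.
Variables (R : realType) (alpha : R) (V : finType) (e : rel V).
Hypothesis alpha01 : 0 < alpha < 1.
Hypothesis dout_gt0 : forall v, (0 < dout e v)%N.
Implicit Types (t u v : V) (h : seq V).

Local Notation run := (bp_run alpha e).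
Local Notation pi := (ppr alpha e).
Local Notation step := (step_pr alpha e).

Let alpha_gt0 : 0 < alpha. Proof. by case/andP: alpha01. Qed.
Let alpha_lt1 : 0 < 1 - alpha. Proof. by rewrite subr_gt0; case/andP: alpha01. Qed.

Lemma residue_ge0 t h v : 0 <= residue (run t h) v.
Proof.
elim: h v => [|x h IH] v /=; first by case: ifP.
rewrite addr_ge0//; first by case: ifP.
by case: ifP => // _; rewrite !mulr_ge0// ?invr_ge0// ltW.
Qed.

(** This is the invariant of Backward Push multiplied by the identity minus the step matrix: it
    involves one step instead of [pi], so a single push preserves it by plain algebra. *)
Lemma bp_invariant t h v :
  reserve (run t h) v + alpha * residue (run t h) v =
  alpha * (v == t)%:R + \sum_w step v w * reserve (run t h) w.
Proof.
elim: h v => [|x h IH] v /=.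
  rewrite add0r big1 ?addr0; last by move=> w _; rewrite mulr0.
  by case: eqP.
rewrite (eq_bigr (fun w => step v w * reserve (run t h) w +
    (if w == x then step v x * (alpha * residue (run t h) x) else 0))); last first.
  by move=> w _; rewrite mulrDr; case: eqVneq => [->|]//; rewrite mulr0.
rewrite big_split/= addrA -IH -big_mkcond/= big_pred1_eq /step_pr.
by case: eqVneq => [->|_]; case: ifP => _; ring.
Qed.

(* The invariant makes the reserve a subsolution of the recurrence of which
   the PageRank vector is the solution, and that recurrence contracts by the factor
   1 - alpha. *)
Lemma reserve_le_ppr t h v : reserve (run t h) v <= pi v t.
Proof.
pose d u := reserve (run t h) u - pi u t.
have dle u : d u <= \sum_w step u w * d w.
  rewrite /d; under eq_bigr do rewrite mulrBr.
  rewrite sumrB; have := bp_invariant t h u.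
  have := ppr_rec alpha01 dout_gt0 u t.
  have := mulr_ge0 (ltW alpha_gt0) (residue_ge0 t h u).
  by lra.
case: (@Order.TotalTheory.arg_maxP _ _ V v predT d isT) => m _ /(_ _ isT) mmax.
have {}mmax u : d u <= d m by exact: mmax.
have dm : d m <= (1 - alpha) * d m.
  apply: le_trans (dle m) _; rewrite -(sum_step_pr alpha dout_gt0 m) mulr_suml.
  by apply: ler_sum => w _; rewrite ler_wpM2l// step_pr_ge0.
have dm0 : d m <= 0.
  have : alpha * d m <= 0 by move: dm; rewrite mulrBl mul1r; lra.
  by rewrite pmulr_rle0.
by rewrite -subr_le0; apply: le_trans (mmax v) dm0.
Qed.

(** A push on [x] can create nonzero residues only at the in-neighbors of [x]. *)
Lemma card_residue_le t h :
  (#|[pred v | residue (run t h) v != 0%R]| <= 1 + \sum_(v <- h) din e v)%N.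
Proof.
elim: h => [|x h IH].
  rewrite big_nil addn0 -(card1 t); apply: subset_leq_card; apply/fintype.subsetP => v.
  by rewrite !inE /=; case: ifP => //; rewrite eqxx.
rewrite big_cons addnCA; apply: (leq_trans _ (leq_add (leqnn (din e x)) IH)).
rewrite /din -cardUI; apply: leq_trans (leq_addr _ _).
apply: subset_leq_card; apply/fintype.subsetP => v; rewrite !inE /=.
case: (e v x) => //=; rewrite addr0; case: ifP => //; by rewrite eqxx.
Qed.

Variable rule : push_rule R V.
Hypothesis rule_valid : valid_rule alpha e rule.

(** Amortization: before the exit, each pushed node has residue above [thr], so the push adds more
    than [alpha * thr] to its reserve. Weighting reserves by the price [1 + din v] of a push pays
    for all of them. *)
Lemma bp_rounds_le (t : V) (thr : R) (k : nat) :
  (k <= loop_exit (fun k => ~~ bp_active alpha e t thr (bp_rounds rule t thr k)))%N ->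
  (\sum_(v <- bp_rounds rule t thr k) (1 + din e v))%:R * (alpha * thr) <=
  \sum_v (1 + din e v)%:R * reserve (run t (bp_rounds rule t thr k)) v.
Proof.
elim: k => [_|k IH kx].
  by rewrite big_nil mul0r sumr_ge0// => v _; rewrite mulr0.
move: (IH (ltnW kx)) => {}IH; have := loop_exit_lt kx; rewrite negbK => act.
have := rule_valid act; rewrite /= -/(bp_rounds rule t thr k).
set h := bp_rounds rule t thr k in IH act *; set x := rule t thr h => thr_x.
rewrite big_cons natrD mulrDl.
rewrite (eq_bigr (fun v => (1 + din e v)%:R * reserve (run t h) v +
    (if v == x then (1 + din e x)%:R * (alpha * residue (run t h) x) else 0))); last first.
  by move=> w _; rewrite mulrDr; case: eqVneq => [->|]//; rewrite mulr0.
rewrite [leRHS]big_split/= -big_mkcond/= big_pred1_eq addrC lerD//.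
by rewrite ler_wpM2l// ler_wpM2l ?(ltW alpha_gt0)// ltW.
Qed.

(** The reserves are bounded by [pi v t]. Writing W for the in-degree sum, the in-neighbor updates
    account for W and the unit per push for at most 1 + W, by [sum_ppr_target_le]. *)
Lemma backward_push_cost_le t (thr : R) : 0 < thr ->
  (backward_push_cost alpha e rule t thr)%:R <=
  1 + (1 + 2 * \sum_v pi v t * (din e v)%:R) / (alpha * thr).
Proof.
move=> thr0; rewrite /backward_push_cost natrD lerD// ler_pdivlMr ?mulr_gt0//.
apply: le_trans (bp_rounds_le (leqnn _)) _.
apply: (@le_trans _ _ (\sum_v (pi v t + pi v t * (din e v)%:R))).
  apply: ler_sum => v _; rewrite natrD mulrDl mul1r [_%:R * _]mulrC lerD//.
    exact: reserve_le_ppr.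
  by rewrite ler_wpM2r// reserve_le_ppr.
rewrite big_split/= mulr_natl mulr2n addrA lerD//.
exact: sum_ppr_target_le.
Qed.

Lemma card_residue_le_cost t (thr : R) :
  (#|[pred v | residue (backward_push alpha e rule t thr) v != 0%R]| <=
   backward_push_cost alpha e rule t thr)%N.
Proof.
apply: leq_trans (card_residue_le _ _) _; rewrite leq_add2l.
by apply: leq_sum => v _; exact: leq_addl.
Qed.

End BackwardPushCost.

(** * Rounding up to natural numbers *)

Lemma natceil_ge (R : realType) (x : R) : x <= (natceil x)%:R.
Proof.
apply: le_trans (ceil_ge x) _; rewrite /natceil -[X in _ <= X]/((`|Num.ceil x|%N%:Z)%:~R) ler_int.
by rewrite abszE ler_norm.
Qed.

Lemma natceil_le (R : realType) (x : R) : 0 <= x -> (natceil x)%:R <= x + 1.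
Proof.
move=> x0; have c0 : 0 <= Num.ceil x by rewrite -(ceil0 R) le_ceil.
rewrite /natceil -[X in X <= _]/((`|Num.ceil x|%N%:Z)%:~R) abszE ger0_norm//.
by have := real_ceilB1_lt (num_real x); rewrite intrB; lra.
Qed.

(** * Phase I: a Chernoff bound for the candidates *)

Section PhaseOne.
Variables (R : realType) (alpha : R) (V : finType) (e : rel V) (s : V) (eps : R).
Hypothesis alpha01 : 0 < alpha < 1.
Hypothesis dout_gt0 : forall v, (0 < dout e v)%N.
Hypothesis eps_gt0 : 0 < eps.

Local Notation n := ((nnodes V)%:R : R).
Local Notation pi := (ppr alpha e).
Local Notation k := (phase1_walks V eps).

Lemma nnodes_ge1 : 1 <= n.
Proof. by rewrite ler1n; apply/card_gt0P; exists s. Qed.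

(** The cost analysis uses only the upper side of the concentration of pi'; the loose factor 4 makes
    a crude exponential-moment bound sufficient. *)
Definition phase1_good (ws : k.-tuple (seq V)) : bool :=
  [forall t, candidates s ws t ==> (pi1 s ws t <= 4 * pi s t)].

Definition chernoff_factor (t : V) (w : seq V) : R :=
  expR ((last s w == t)%:R / 2 - pi s t).

Lemma expR_half_le2 : expR (2^-1) <= 2 :> R.
Proof.
rewrite -[leLHS]invrK -expRN -[leRHS]invrK lef_pV2 ?posrE ?expR_gt0//.
by apply: le_trans (expR_ge1Dx _); lra.
Qed.

(** With I the indicator of ending at [t], exp(I / 2) <= 1 + I since exp(1 / 2) <= 2; the mean of 1
    + I is at most 1 + pi <= exp(pi), which the normalization cancels. *)
Lemma expect_chernoff_factor t :
  (expect (walk_pr alpha e s) (fun w => (chernoff_factor t w)%:E) <= 1)%E.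
Proof.
have walk0 := walk_pr_ge0 e alpha01 s.
apply: (@le_trans _ _ (expect (walk_pr alpha e s) (fun w =>
    (expR (- pi s t))%:E * (cst 1 w + (last s w == t)%:R%:E))%E)).
  apply: le_expect => // w; rewrite -EFinD -EFinM lee_fin /chernoff_factor.
  rewrite addrC expRD ler_wpM2l ?expR_ge0//.
  case: eqP => _; last by rewrite mul0r expR0 addr0.
  by rewrite mul1r; exact: expR_half_le2.
rewrite expectZ ?expR_ge0//; last by move=> w; rewrite adde_ge0// lee_fin.
rewrite expectD//.
rewrite -pprE//.
apply: (@le_trans _ _ ((expR (- pi s t))%:E * (1 + (pi s t)%:E))%E).
  by rewrite lee_wpmul2l ?lee_fin ?expR_ge0// leeD2r// expect_walk_cst1.
rewrite -EFinD -EFinM lee_fin expRN mulrC ler_pdivrMr ?expR_gt0// mul1r.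
exact: expR_ge1Dx.
Qed.

Lemma ln_2n3_ge0 : 0 <= ln (2 * n ^+ 3).
Proof.
apply: ln_ge0; have := exprn_ege1 3 nnodes_ge1; lra.
Qed.

(** Let c count the walks ending at [t]. Then c > 4 k pi and c > k eps / 2, so the exponent c / 2 -
    k pi exceeds c / 4 > k eps / 8, which is at least 3 / 2 times [ln (2 * n ^+ 3)]. *)
Lemma chernoff_of_bad (ws : k.-tuple (seq V)) t :
  candidates s ws t -> 4 * pi s t < pi1 s ws t ->
  2 * n ^+ 3 <= \prod_(w <- ws) chernoff_factor t w.
Proof.
have n1 := nnodes_ge1.
have N0 : 0 < 2 * n ^+ 3 by rewrite mulr_gt0// exprn_gt0// (lt_le_trans ltr01).
rewrite /candidates/= /pi1 /monte_carlo size_tuple.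
set c := count _ _ => c_eps c_pi.
have kge : 12 * ln (2 * n ^+ 3) <= k%:R * eps.
  by rewrite -ler_pdivrMr//; exact: natceil_ge.
(* With no walks, division by zero would give [pi1] the value 0, and [t] would not be a
   candidate. *)
have k0 : 0 < k%:R :> R.
  rewrite lt0r ler0n andbT; apply: contraTneq c_eps => ->.
  by rewrite invr0 mulr0 -leNgt divr_ge0// ltW.
move: c_eps c_pi; rewrite !ltr_pdivlMr// => c_eps c_pi.
rewrite -expR_sum sumrB -mulr_suml.
have -> : \sum_(w <- ws) (last s w == t)%:R = c%:R :> R.
  rewrite /c -sum1_count natr_sum [RHS]big_mkcond/=.
  by apply: eq_bigr => w _; case: eqP.
rewrite big_const_seq count_predT size_tuple iter_addr_0 -[pi s t *+ _]mulr_natr.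
rewrite -[leLHS]lnK ?posrE// ler_expR.
have := ln_2n3_ge0; nra.
Qed.

(** Markov's inequality and the union bound over [t], stated pointwise on indicators. *)
Lemma bad_le_chernoff (ws : k.-tuple (seq V)) :
  (~~ phase1_good ws)%:R <=
  (2 * n ^+ 3)^-1 * \sum_t \prod_(w <- ws) chernoff_factor t w.
Proof.
have n1 := nnodes_ge1.
have N0 : 0 < 2 * n ^+ 3 by rewrite mulr_gt0// exprn_gt0// (lt_le_trans ltr01).
have P0 t : 0 <= \prod_(w <- ws) chernoff_factor t w.
  by rewrite prodr_ge0// => w _; exact: expR_ge0.
case: (boolP (phase1_good ws)) => [_|]; first by rewrite mulr_ge0 ?sumr_ge0// invr_ge0 ltW.
case/forallPn => t; rewrite negb_imply -ltNge => /andP[ct tpi].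
rewrite ler_pdivlMl// mulr1 (bigD1 t)//= -[leLHS]addr0 lerD ?sumr_ge0//.
exact: chernoff_of_bad.
Qed.

Lemma expect_bad_le :
  (expect (iid_pr (walk_pr alpha e s) (k := k)) (fun ws => (~~ phase1_good ws)%:R%:E) <=
   (n ^- 2)%:E)%E.
Proof.
have n1 := nnodes_ge1.
have N0 : 0 < 2 * n ^+ 3 by rewrite mulr_gt0// exprn_gt0// (lt_le_trans ltr01).
have walk0 := walk_pr_ge0 e alpha01 s.
have iid0 := @iid_pr_ge0 _ _ _ walk0 k.
have P0 t (ws : seq (seq V)) : 0 <= \prod_(w <- ws) chernoff_factor t w.
  by rewrite prodr_ge0// => w _; exact: expR_ge0.
apply: le_trans (le_expect iid0 (g := fun ws =>
    ((2 * n ^+ 3)^-1%:E * \sum_t (\prod_(w <- ws) chernoff_factor t w)%:E)%E) _) _.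
  by move=> ws; rewrite sumEFin -EFinM lee_fin bad_le_chernoff.
rewrite expectZ; last 3 first.
- exact: iid0.
- by rewrite invr_ge0 ltW.
- by move=> ws; apply: sume_ge0 => t _; rewrite lee_fin.
rewrite expect_sum; last 2 first.
- exact: iid0.
- by move=> t ws; rewrite lee_fin.
apply: (@le_trans _ _ ((2 * n ^+ 3)^-1%:E * \sum_(t : V) 1%:E)%E).
  rewrite lee_wpmul2l ?lee_fin ?invr_ge0 ?(ltW N0)//; apply: lee_sum => t _.
  apply: expect_iid_prod => //; last exact: expect_chernoff_factor.
  by move=> w; exact: expR_ge0.
rewrite sumEFin -EFinM lee_fin sumr_const -[#|V|%:R]/n.
have nn0 : n != 0 by rewrite gt_eqF// (lt_le_trans ltr01).
have -> : (2 * n ^+ 3)^-1 * n = n ^- 2 / 2 by field.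
by rewrite ler_pdivrMr// ler_peMr ?invr_ge0 ?exprn_ge0// ler1n.
Qed.

End PhaseOne.

(** * Constants depending on [alpha] only *)

Section Constants.
Variables (R : realType) (alpha : R).
Hypothesis alpha01 : 0 < alpha < 1.

(** The lower bound of [push_weight_ge]. *)
Definition weight_lb : R := alpha ^+ 2 * (1 - alpha).
(* In push_const, 48 = 6 * 4 * 2: the 6 of r_max, the 4 of phase1_good, and the
   halving of the threshold in a trial. *)
Definition push_const : R := 2 / weight_lb + 48 * (weight_lb^-1 + 2) / alpha.
(** The terms pay for the pushes of a trial, for its initial unit and, when n_r < X, for its
    budget. *)
Definition trial_const : R := push_const + weight_lb^-1 + alpha^-1.
Definition walks_const : R := 1 + 2 * trial_const / alpha.
Definition phase2_const : R := trial_const + walks_const / alpha + weight_lb^-1.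
Definition phase3_const : R := walks_const / alpha + 2 * trial_const.

Lemma weight_lb_gt0 : 0 < weight_lb.
Proof.
by case/andP: alpha01 => a0 a1; rewrite mulr_gt0 ?exprn_gt0 ?subr_gt0.
Qed.

Lemma weight_lb_le1 : weight_lb <= 1.
Proof.
case/andP: alpha01 => a0 a1; rewrite -[leRHS]mulr1 ler_pM ?exprn_ge0 ?(ltW a0)//.
- by rewrite subr_ge0 ltW.
- by rewrite exprn_ile1 ?ltW.
- by rewrite gerBl ltW.
Qed.

Let alpha_ge0 : 0 <= alpha. Proof. by case/andP: alpha01 => /ltW. Qed.
Let delta_ge0 : 0 <= weight_lb. Proof. exact: ltW weight_lb_gt0. Qed.
Let alphaV_ge0 : 0 <= alpha^-1. Proof. by rewrite invr_ge0. Qed.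
Let deltaV_ge0 : 0 <= weight_lb^-1. Proof. by rewrite invr_ge0. Qed.

Lemma push_const_ge0 : 0 <= push_const.
Proof.
have h : 0 <= (weight_lb^-1 + 2) / alpha by rewrite divr_ge0// addr_ge0.
by have := deltaV_ge0; rewrite /push_const -[48 * _ / _]mulrA; lra.
Qed.

Lemma trial_const_ge0 : 0 <= trial_const.
Proof.
have := push_const_ge0; have := alphaV_ge0; have := deltaV_ge0.
by rewrite /trial_const; lra.
Qed.

Lemma walks_const_ge1 : 1 <= walks_const.
Proof. by rewrite lerDl divr_ge0 ?mulr_ge0 ?trial_const_ge0. Qed.

Let walks_const_ge0 : 0 <= walks_const.
Proof. exact: le_trans walks_const_ge1. Qed.

Lemma phase2_const_ge0 : 0 <= phase2_const.
Proof.
have := divr_ge0 walks_const_ge0 alpha_ge0; have := trial_const_ge0.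
by have := deltaV_ge0; rewrite /phase2_const; lra.
Qed.

Lemma phase3_const_ge0 : 0 <= phase3_const.
Proof.
have := divr_ge0 walks_const_ge0 alpha_ge0; have := trial_const_ge0.
by rewrite /phase3_const; lra.
Qed.

End Constants.

(** * Cost of Phases II and III *)

Section PhaseTwoThree.
Variables (R : realType) (alpha : R) (V : finType) (e : rel V).
Variables (rule : push_rule R V) (s : V) (eps : R).
Hypothesis alpha01 : 0 < alpha < 1.
Hypothesis dout_gt0 : forall v, (0 < dout e v)%N.
Hypothesis rule_valid : valid_rule alpha e rule.
Hypothesis eps01 : 0 < eps < 1.

Local Notation n := ((nnodes V)%:R : R).
Local Notation pi := (ppr alpha e).
Local Notation PW := (push_weight alpha e s).
Local Notation N0 := (natceil (n / eps)).
Local Notation nt := ((n_t R V)%:R : R).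
Local Notation mean := (mean_walk_cost alpha e s).

Definition time_bound : R := eps^-1 * Num.sqrt PW.
Local Notation X := time_bound.

Let alpha_gt0 : 0 < alpha. Proof. by case/andP: alpha01. Qed.
Let eps_gt0 : 0 < eps. Proof. by case/andP: eps01. Qed.
Let delta_gt0 := weight_lb_gt0 alpha01.
Let n1 : 1 <= n := nnodes_ge1 R s.

Lemma push_weight_gt0 : 0 < PW.
Proof. by apply: lt_le_trans delta_gt0 _; exact: push_weight_ge. Qed.

(** Being at most 1, [weight_lb] lies below its own square root, hence below that of [push_weight];
    so no square root enters the constants. *)
Lemma time_bound_ge_inv : eps^-1 <= X / weight_lb alpha.
Proof.
rewrite /time_bound -mulrA ler_peMr ?invr_ge0 ?(ltW eps_gt0)//.
rewrite ler_pdivlMr// mul1r; apply: (@le_trans _ _ (Num.sqrt (weight_lb alpha))).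
  rewrite -[leLHS]ger0_norm ?(ltW delta_gt0)// -sqrtr_sqr ler_wsqrtr//.
  by rewrite expr2 ler_piMr ?(ltW delta_gt0)// weight_lb_le1.
by rewrite ler_wsqrtr//; exact: push_weight_ge.
Qed.

Lemma time_bound_gt0 : 0 < X.
Proof. by rewrite mulr_gt0 ?invr_gt0// sqrtr_gt0 push_weight_gt0. Qed.

Lemma time_bound_ge1 : 1 <= X / weight_lb alpha.
Proof.
apply: le_trans time_bound_ge_inv; rewrite invf_ge1 ?ltW//.
by case/andP: eps01.
Qed.

Lemma time_bound_sqr : PW / eps ^+ 2 = X ^+ 2.
Proof. by rewrite exprMn sqr_sqrtr ?(ltW push_weight_gt0)// exprVn mulrC. Qed.

Lemma N0_ge : n / eps <= N0%:R.
Proof. exact: natceil_ge. Qed.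

(** Since [push_weight] is at most m <= n ^ 2, the initial n_r is already at least the balancing
    value X, and halving approaches it from above. *)
Lemma time_bound_le_N0 : X <= N0%:R.
Proof.
apply: le_trans N0_ge; rewrite /time_bound mulrC ler_wpM2r ?invr_ge0 ?(ltW eps_gt0)//.
rewrite -[leRHS]ger0_norm// -sqrtr_sqr ler_wsqrtr//.
apply: le_trans (push_weight_le alpha01 dout_gt0 s) _.
by rewrite -natrX ler_nat nedges_le.
Qed.

Lemma N0_gt0 : 0 < N0%:R :> R.
Proof. exact: lt_le_trans time_bound_gt0 time_bound_le_N0. Qed.

Lemma n_t_ge1 : 1 <= nt.
Proof.
rewrite ler1n -(ltr0n R); apply: lt_le_trans (natceil_ge _).
rewrite mulr_gt0// ln_gt0//; have := exprn_ege1 2 n1; lra.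
Qed.

(** Compares the floored n_r, which sets the budget, with the exact power of 2 that scales
    [r_max]. *)
Lemma n_r_pow_le j : (n_r V eps j * 2 ^ j <= N0)%N.
Proof.
elim: j => [|j IH]; first by rewrite muln1.
apply: leq_trans IH; rewrite expnS mulnA leq_mul2r /n_r /= muln2.
by rewrite -[leqRHS]odd_double_half leq_addl orbT.
Qed.

Section GoodWalks.
Variable ws : (phase1_walks V eps).-tuple (seq V).
Hypothesis ws_good : phase1_good alpha e s ws.

Local Notation cand := (candidates s ws).
Local Notation H := (halvings alpha e rule s ws).

Definition push_total (j : nat) : nat :=
  (\sum_(t | cand t) backward_push_cost alpha e rule t (r_max s ws j t))%N.

Lemma sum_pi1_le1 : \sum_t pi1 s ws t <= 1.
Proof.
rewrite /pi1 /monte_carlo -mulr_suml -natr_sum.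
rewrite (eq_bigr (fun v => \sum_(w <- ws | last s w == v) 1)%N); last first.
  by move=> v _; rewrite sum1_count.
rewrite (exchange_big_dep predT)//= (eq_bigr (fun=> 1%N)); last first.
  by move=> w _; rewrite (big_pred1 (last s w))// => v; rewrite eq_sym.
rewrite sum1_size; case: (size ws) => [|m]; first by rewrite invr0 mulr0.
by rewrite mulfV.
Qed.

Lemma pi1_ge0 t : 0 <= pi1 s ws t.
Proof. by rewrite divr_ge0. Qed.

(** Each candidate has frequency above [eps / 2], and the frequencies sum to at most 1. *)
Lemma card_candidates_le : (\sum_(t | cand t) 1)%N%:R <= 2 / eps.
Proof.
rewrite ler_pdivlMr//.
suff : (\sum_(t | cand t) 1)%N%:R * (eps / 2) <= 1 by lra.
rewrite natr_sum mulr_suml.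
apply: (@le_trans _ _ (\sum_(t | cand t) pi1 s ws t)).
  by apply: ler_sum => t ct; rewrite mul1r ltW.
apply: le_trans sum_pi1_le1; rewrite big_mkcond; apply: ler_sum => t _.
by case: ifP => // _; exact: pi1_ge0.
Qed.

Lemma candidate_pi1 t : cand t -> 0 < pi1 s ws t <= 4 * pi s t.
Proof.
move=> ct; have /forallP/(_ t) := ws_good; rewrite ct/= => ->.
by rewrite andbT; apply: lt_trans ct; rewrite divr_gt0.
Qed.

(** A trial in round j uses the thresholds in force after one more halving, so [push_total j.+1]
    measures its pushes. *)
Lemma r_maxS j t : r_max s ws j t / 2 = r_max s ws j.+1 t.
Proof. by rewrite /r_max [2 ^+ j.+1]exprSr [(2 ^+ j * 2)^-1]invfM [RHS]mulrA. Qed.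

(** The threshold of [t] is inversely proportional to [pi1], which is at most 4 pi; hence the cost
    for [t] is weighted by [pi s t] and the sum rebuilds [push_weight]. Here 24 = 6 * 4, and
    [2 / eps] pays one unit per candidate. *)
Lemma push_total_le j :
  (push_total j)%:R <=
  2 / eps + 24 * (1 + 2 * PW) * 2 ^+ j / (alpha * eps ^+ 2 * N0%:R).
Proof.
have N0' := N0_gt0.
apply: (@le_trans _ _ (\sum_(t | cand t) (1 + 24 * (pi s t *
    (1 + 2 * \sum_v pi v t * (din e v)%:R)) * 2 ^+ j / (alpha * eps ^+ 2 * N0%:R)))).
  rewrite /push_total natr_sum; apply: ler_sum => t ct.
  have /andP[p0 p4] := candidate_pi1 ct.
  have r0 : 0 < r_max s ws j t.
    apply: divr_gt0; last exact: exprn_gt0.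
    by apply: divr_gt0; apply: mulr_gt0 => //; exact: exprn_gt0.
  apply: le_trans (backward_push_cost_le alpha01 dout_gt0 rule_valid t r0) _.
  rewrite lerD2l /r_max.
  set W := 1 + _; have W0 : 0 <= W by rewrite addr_ge0 ?mulr_ge0 ?sum_ppr_din_ge0.
  have -> : W / (alpha * (eps ^+ 2 * N0%:R / (6 * pi1 s ws t) / 2 ^+ j)) =
    6 * pi1 s ws t * W * 2 ^+ j / (alpha * eps ^+ 2 * N0%:R).
    by field; rewrite !gt_eqF ?exprn_gt0.
  rewrite ler_pM2r ?invr_gt0 ?mulr_gt0 ?exprn_gt0// ler_pM2r ?exprn_gt0//.
  rewrite mulrA ler_wpM2r//; lra.
rewrite big_split/= lerD//.
  by apply: le_trans card_candidates_le; rewrite natr_sum.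
rewrite -!mulr_suml -mulr_sumr ler_pM2r ?invr_gt0 ?mulr_gt0 ?exprn_gt0//.
rewrite ler_pM2r ?exprn_gt0// ler_pM2l//.
apply: (@le_trans _ _ (\sum_t pi s t * (1 + 2 * \sum_v pi v t * (din e v)%:R))).
  rewrite big_mkcond; apply: ler_sum => t _; case: ifP => // _.
  by rewrite mulr_ge0 ?ppr_ge0 ?addr_ge0 ?mulr_ge0 ?sum_ppr_din_ge0.
rewrite (eq_bigr (fun t => pi s t + 2 * (pi s t * \sum_v pi v t * (din e v)%:R))); last first.
  by move=> t _; ring.
by rewrite big_split/= -mulr_sumr lerD2r sum_ppr_le1.
Qed.

(** The main term of [push_total_le] is O(2 ^ i X ^ 2 / N0), and the hypothesis trades one factor X
    away. The slack 2 in it admits i = j + 1 whenever n_r in round j is at least X. *)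
Lemma push_total_le_time i : 2 ^+ i * X <= 2 * N0%:R ->
  (push_total i)%:R <= push_const alpha * X.
Proof.
move=> iX; apply: le_trans (push_total_le i) _.
have N0' := N0_gt0; have X0 := time_bound_gt0; have PW0 := push_weight_gt0.
rewrite /push_const [leRHS]mulrDl lerD//.
  by rewrite -mulrA ler_pM2l// mulrC; exact: time_bound_ge_inv.
apply: (@le_trans _ _ (24 * ((weight_lb alpha)^-1 + 2) / alpha *
    (2 ^+ i * X ^+ 2 / N0%:R))).
  rewrite -time_bound_sqr.
  have -> : 24 * ((weight_lb alpha)^-1 + 2) / alpha *
      (2 ^+ i * (PW / eps ^+ 2) / N0%:R) =
    24 * ((weight_lb alpha)^-1 * PW + 2 * PW) * 2 ^+ i / (alpha * eps ^+ 2 * N0%:R).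
    by field; rewrite !gt_eqF.
  rewrite ler_pM2r ?invr_gt0 ?mulr_gt0 ?exprn_gt0// ler_pM2r ?exprn_gt0//.
  rewrite ler_pM2l// lerD2r ler_pdivlMl// mulr1; exact: push_weight_ge.
have -> : 48 * ((weight_lb alpha)^-1 + 2) / alpha * X =
  24 * ((weight_lb alpha)^-1 + 2) / alpha * (2 * X) by ring.
rewrite ler_wpM2l//.
  by rewrite divr_ge0 ?mulr_ge0 ?addr_ge0 ?invr_ge0 ?ltW.
rewrite ler_pdivrMr// expr2 mulrA.
have -> : 2 * X * N0%:R = 2 * N0%:R * X by ring.
by rewrite ler_pM2r.
Qed.

Lemma trial_full_costE j : trial_full_cost alpha e rule s ws j = (push_total j.+1).+1.
Proof.
rewrite /trial_full_cost add1n; congr S; apply: eq_bigr => t _.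
by rewrite r_maxS.
Qed.

Lemma trial_full_cost_le_time j : X <= (n_r V eps j)%:R ->
  (trial_full_cost alpha e rule s ws j)%:R <= trial_const alpha * X.
Proof.
move=> Xn; rewrite trial_full_costE -natr1.
have h : (push_total j.+1)%:R <= push_const alpha * X.
  apply: push_total_le_time; rewrite exprS -mulrA ler_pM2l//.
  have := n_r_pow_le j; rewrite -(ler_nat R) natrM natrX => h.
  by apply: le_trans h; rewrite mulrC ler_wpM2r ?exprn_ge0.
have := time_bound_ge1; rewrite mulrC => h1.
have h2 : 0 <= alpha^-1 * X by rewrite mulr_ge0 ?invr_ge0 ?ltW ?time_bound_gt0.
by rewrite /trial_const; lra.
Qed.

Lemma trial_budget_ge0 j : 0 <= trial_budget alpha e s eps j.
Proof.
rewrite /trial_budget !mulr_ge0//.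
have /andP[h _] := mean_walk_cost_bounds alpha01 dout_gt0 s.
by apply: le_trans h; exact: ltW.
Qed.

Lemma trial_budget_le j (Y : R) : (n_r V eps j)%:R <= Y ->
  trial_budget alpha e s eps j <= alpha^-1 * (nt * Y).
Proof.
move=> nY; have /andP[h0 h1] := mean_walk_cost_bounds alpha01 dout_gt0 s.
have Y0 : 0 <= Y by apply: le_trans nY.
rewrite /trial_budget mulrC; apply: ler_pM => //.
- by apply: le_trans h0; exact: ltW.
- by rewrite ler_wpM2l//; lra.
Qed.

(** After N0 halvings n_r is 0, so the budget vanishes while a trial costs at least one unit: the
    loop exits and [halvings] is not the dummy value. *)
Lemma halvings_exceeds : trial_exceeds alpha e rule s ws H.
Proof.
apply: loop_exitP; exists N0; rewrite /trial_exceeds /trial_budget.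
have -> : n_r V eps N0 = 0%N.
  apply/eqP; rewrite -leqn0 leqNgt; apply/negP => n0.
  have := n_r_pow_le N0; rewrite leqNgt => /negP; apply.
  by apply: leq_trans (ltn_expl N0 (ltnSn 1)) _; rewrite leq_pmull.
by rewrite mul0r mulr0 mul0r ltr0n trial_full_costE.
Qed.

(** The last trial before the exit stays within its budget, so its n_r is at least 1. *)
Lemma halvings_pow_le : (2 ^ H <= 2 * N0)%N.
Proof.
case E : H => [|j].
  by rewrite muln_gt0/= -(ltr0n R) N0_gt0.
have /loop_exit_lt : (j < H)%N by rewrite E.
rewrite -/H /trial_exceeds -leNgt => h.
rewrite expnS leq_mul2l/=; apply: leq_trans (n_r_pow_le j).
rewrite leq_pmull// lt0n; apply/negP => /eqP n0; move: h.
by rewrite /trial_budget n0 mul0r mulr0 mul0r trial_full_costE lern0.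
Qed.

Lemma trial_cost_le_time j : (j < H)%N ->
  (trial_full_cost alpha e rule s ws j)%:R <= trial_const alpha * (nt * X).
Proof.
move=> jH; have X0 := time_bound_gt0; have ntX : X <= nt * X.
  by rewrite ler_peMl ?n_t_ge1// ltW.
have c0 := trial_const_ge0 alpha01.
case: (leP X (n_r V eps j)%:R) => Xn.
  by apply: le_trans (trial_full_cost_le_time Xn) _; rewrite ler_wpM2l.
have := loop_exit_lt jH; rewrite -/H /trial_exceeds -leNgt => /le_trans; apply.
apply: le_trans (trial_budget_le (ltW Xn)) _; rewrite ler_wpM2r//.
  by rewrite mulr_ge0// ltW.
rewrite lerDr; apply: addr_ge0; first exact: push_const_ge0.
by rewrite invr_ge0 ltW.
Qed.

(** If n_r is at least X at the exit, the trial costs O(X) but exceeds a budget of at least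
    [alpha / 2] times n_r, by the lower bound on the mean walk cost. *)
Lemma phase3_walks_le : (phase3_walks alpha e rule s ws)%:R <= walks_const alpha * X.
Proof.
have X0 := time_bound_gt0; have c0 := trial_const_ge0 alpha01.
rewrite /phase3_walks; case: (leP X (n_r V eps H)%:R) => Xn; last first.
  by apply: le_trans (ltW Xn) _; rewrite ler_peMl ?walks_const_ge1// ltW.
have := trial_full_cost_le_time Xn; have := halvings_exceeds.
rewrite /trial_exceeds /trial_budget => h1 /(lt_le_trans h1) h2.
have /andP[m0 _] := mean_walk_cost_bounds alpha01 dout_gt0 s.
have h3 : (n_r V eps H)%:R / 2 * alpha <= trial_const alpha * X.
  apply: le_trans (ltW h2); rewrite ler_pM ?(ltW alpha_gt0)//.
  by rewrite ler_peMl ?n_t_ge1.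
apply: (@le_trans _ _ (2 * trial_const alpha / alpha * X)).
  by rewrite mulrAC ler_pdivlMr// -mulrA; lra.
by rewrite ler_wpM2r ?(ltW X0)// lerDr.
Qed.

(** The final pushes repeat those of the last completed trial. With no completed trial, the initial
    n_r is at least X and the pushes are cheap anyway. *)
Lemma push_total_halvings_le : (push_total H)%:R <= trial_const alpha * (nt * X).
Proof.
have X0 := time_bound_gt0; case E : H => [|j].
  apply: (@le_trans _ _ (push_const alpha * X)).
    apply: push_total_le_time; rewrite expr0 mul1r.
    by have := time_bound_le_N0; have := N0_gt0; lra.
  rewrite ler_pM ?push_const_ge0 ?(ltW X0)//.
    by rewrite /trial_const -addrA lerDl addr_ge0// invr_ge0 ltW.
  by rewrite ler_peMl ?n_t_ge1// ltW.
apply: le_trans (trial_cost_le_time (_ : (j < H)%N)); last by rewrite E.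
by rewrite trial_full_costE ler_nat.
Qed.

Lemma phase2_cost_le : (phase2_cost alpha e rule s ws)%:R <=
  phase2_const alpha * (H.+1%:R * (nt * X)).
Proof.
have X0 := time_bound_gt0.
have ntX0 : 0 <= nt * X by rewrite mulr_ge0// ltW.
rewrite /phase2_cost -/(push_total H) big_ord_recr/= !natrD.
have h1 : (\sum_(i < H) trial_cost alpha e rule s ws i)%:R <=
    H%:R * (trial_const alpha * (nt * X)).
  rewrite natr_sum mulr_natl -[X in _ *+ X]card_ord -sumr_const.
  apply: ler_sum => j _; rewrite /trial_cost; case: ifP => ex; last exact: trial_cost_le_time.
  by have := loop_exit_lt (ltn_ord j); rewrite ex.
(* The interrupted trial costs at most its budget plus the unit that overruns it. *)
have h2 : (trial_cost alpha e rule s ws H)%:R <=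
    (walks_const alpha / alpha + (weight_lb alpha)^-1) * (nt * X).
  rewrite /trial_cost halvings_exceeds -natr1 mulrDl lerD//.
    apply: le_trans (_ : trial_budget alpha e s eps H <= _).
      by rewrite truncn_le ?trial_budget_ge0.
    apply: le_trans (trial_budget_le phase3_walks_le) _.
    by rewrite le_eqVlt; apply/orP; left; apply/eqP; ring.
  apply: le_trans time_bound_ge1 _; rewrite mulrC ler_pM2l ?invr_gt0//.
  by rewrite ler_peMl ?n_t_ge1// ltW.
have h3 := push_total_halvings_le.
have w0 : 0 <= walks_const alpha / alpha + (weight_lb alpha)^-1.
  apply: addr_ge0; last by rewrite invr_ge0 ltW.
  apply: divr_ge0; last exact: ltW.
  exact: le_trans (walks_const_ge1 alpha01).
rewrite /phase2_const -natr1.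
set B := nt * X in ntX0 h1 h2 h3 *.
have := mulr_ge0 w0 (mulr_ge0 (ler0n R H) ntX0).
nra.
Qed.

(** For each candidate, both the extra unit and the number of nonzero residues are at most the cost
    of its final push, hence the factor 2. *)
Lemma estimates_cost_le : (estimates_cost alpha e rule s ws)%:R <=
  2 * trial_const alpha * (nt * X).
Proof.
rewrite -mulrA; apply: le_trans (_ : 2 * (push_total H)%:R <= _); last first.
  by rewrite ler_pM2l ?push_total_halvings_le.
rewrite -natrM ler_nat /push_total big_distrr/=; apply: leq_sum => t _.
rewrite mul2n -addnn; apply: leq_add; first exact: leq_addr.
exact: card_residue_le_cost.
Qed.

(** Linearity of expectation is applied twice: to the walks of a batch, then to the batches. *)
Lemma expect_phase3_cost_le :
  (expect (iid_pr (iid_pr (walk_pr alpha e s) (k := phase3_walks alpha e rule s ws)) (k := n_t R V))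
     (fun yss => (phase3_cost yss)%:R%:E) <=
   (phase3_const alpha * (nt ^+ 2 * X))%:E)%E.
Proof.
have X0 := time_bound_gt0.
have walk0 := walk_pr_ge0 e alpha01 s.
set k := phase3_walks _ _ _ _ _.
have iid0 := @iid_pr_ge0 _ _ _ walk0 k.
have walk1 := expect_walk_cst1 alpha01 dout_gt0 s.
have iid1 := expect_iid_cst1 walk0 walk1 k.
pose est : R := (estimates_cost alpha e rule s ws)%:R.
pose mu := k%:R * alpha^-1 + est.
have mu0 : 0 <= mu by rewrite addr_ge0// mulr_ge0// invr_ge0 ltW.
have batch : (expect (iid_pr (walk_pr alpha e s) (k := k))
    (fun ys => ((monte_carlo_cost ys)%:R + est)%:E) <= mu%:E)%E.
  under eq_expect do rewrite EFinD.
  rewrite expectD//; last by move=> ys; rewrite lee_fin.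
  rewrite EFinD leeD//; last exact: (expect_cst_le iid0 iid1).
  under eq_expect do rewrite /monte_carlo_cost natr_sum.
  apply: expect_iid_sum => //; first by rewrite invr_ge0 ltW.
  exact: expect_walk_cost.
apply: (@le_trans _ _ (nt * mu)%:E).
  under eq_expect do rewrite /phase3_cost natr_sum.
  under eq_expect do under eq_bigr do rewrite natrD.
  apply: (expect_iid_sum iid0 iid1 _ _ mu0 batch).
  by move=> ys; rewrite addr_ge0.
rewrite lee_fin expr2 -mulrA mulrCA ler_wpM2l//.
rewrite /mu /phase3_const [leRHS]mulrDl lerD//; last exact: estimates_cost_le.
apply: (@le_trans _ _ (walks_const alpha * X / alpha)).
  by rewrite ler_wpM2r ?invr_ge0 ?(ltW alpha_gt0)//; exact: phase3_walks_le.
rewrite mulrAC ler_wpM2l//; last by rewrite ler_peMl ?n_t_ge1// ltW.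
apply: divr_ge0; last exact: ltW.
exact: le_trans (walks_const_ge1 alpha01).
Qed.

End GoodWalks.

End PhaseTwoThree.

(** * Expected time with the cap and the Power Method *)

Section ExpectedTime.
Variables (R : realType) (alpha c1 c2 : R).
Hypothesis alpha01 : 0 < alpha < 1.
Hypothesis c1_gt0 : 0 < c1.

(** The number of Power Method iterations per unit of ln (1 / eps). *)
Definition power_const : R := - (ln (1 - alpha))^-1.

(** Times 1 + ln n, this bounds the overhead factor of [cost_le_slowdown] for moderate [eps]. *)
Definition slowdown_const : R := 1 + 2 * (3 * power_const + 1) / c1.

Definition fallback_const : R :=
  (`|c2| + 2 * (3 * power_const + 1)) / weight_lb alpha.

(* 37 and 9 are the constants of n_t_le_log, phase1_walks_le_log and
   halvings_le_log; 333 = 9 * 37 and 1369 = 37 ^ 2. *)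
Definition phases_const : R :=
  slowdown_const * (37 / (alpha * weight_lb alpha) + 333 * phase2_const alpha +
    1369 * phase3_const alpha) + fallback_const.

Definition time_const : R := 1 + phases_const + fallback_const.

Lemma power_const_ge0 : 0 <= power_const.
Proof.
rewrite oppr_ge0 invr_le0 ln_le0//.
by case/andP: alpha01 => /ltW a0 _; rewrite gerBl.
Qed.

Lemma slowdown_const_ge1 : 1 <= slowdown_const.
Proof.
rewrite lerDl divr_ge0 ?(ltW c1_gt0)//.
by have := power_const_ge0; lra.
Qed.

Lemma fallback_const_ge0 : 0 <= fallback_const.
Proof.
apply: divr_ge0; last exact: ltW (weight_lb_gt0 alpha01).
by have := power_const_ge0; have := normr_ge0 c2; lra.
Qed.

Lemma phases_const_ge0 : 0 <= phases_const.
Proof.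
apply: addr_ge0; last exact: fallback_const_ge0.
apply: mulr_ge0; first exact: le_trans slowdown_const_ge1.
have := phase2_const_ge0 alpha01; have := phase3_const_ge0 alpha01.
have : 0 <= 37 / (alpha * weight_lb alpha).
  apply: divr_ge0 => //; apply: mulr_ge0; last exact: ltW (weight_lb_gt0 alpha01).
  by case/andP: alpha01 => /ltW.
by lra.
Qed.

Variables (V : finType) (e : rel V) (rule : push_rule R V) (s : V) (eps cap : R).
Hypothesis dout_gt0 : forall v, (0 < dout e v)%N.
Hypothesis rule_valid : valid_rule alpha e rule.
Hypothesis eps01 : 0 < eps < 1.
Hypothesis cap_bounds : c1 * (nnodes V)%:R ^+ 2 <= cap <= c2 * (nnodes V)%:R ^+ 2.

Local Notation n := ((nnodes V)%:R : R).
Local Notation L := (1 + ln n).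
Local Notation X := (time_bound alpha e s eps).
Local Notation k := (phase1_walks V eps).
Local Notation iters := (power_iters alpha eps).
Local Notation power_cost := ((power_method_cost alpha e eps)%:R : R).

Let alpha_gt0 : 0 < alpha. Proof. by case/andP: alpha01. Qed.
Let eps_gt0 : 0 < eps. Proof. by case/andP: eps01. Qed.
Let eps_lt1 : eps < 1. Proof. by case/andP: eps01. Qed.
Let delta_gt0 := weight_lb_gt0 alpha01.
Let n1 : 1 <= n := nnodes_ge1 R s.
Let n_gt0 : 0 < n. Proof. exact: lt_le_trans n1. Qed.
Let ln_n_ge0 : 0 <= ln n. Proof. exact: ln_ge0. Qed.
Let X_gt0 : 0 < X. Proof. exact: time_bound_gt0. Qed.

Lemma cap_gt0 : 0 < cap.
Proof.
case/andP: cap_bounds => h _; apply: lt_le_trans h.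
by rewrite mulr_gt0 ?exprn_gt0.
Qed.

Lemma cap_le : cap <= `|c2| * n ^+ 2.
Proof.
case/andP: cap_bounds => _ /le_trans; apply.
by rewrite ler_wpM2r ?exprn_ge0// ler_norm.
Qed.

Lemma power_iters_le : iters%:R <= power_const * ln eps^-1 + 1.
Proof.
have -> : power_const * ln eps^-1 = ln eps / ln (1 - alpha).
  by rewrite lnV ?posrE// mulrNN mulrC.
apply: natceil_le; rewrite -mulrNN mulr_ge0 ?oppr_ge0//.
  by rewrite ln_le0 ?ltW.
by rewrite -oppr_ge0; exact: power_const_ge0.
Qed.

Lemma power_cost_le : power_cost <= 2 * iters%:R * n ^+ 2.
Proof.
rewrite /power_method_cost natrM -mulrA mulrCA ler_wpM2l// natrD.
have h1 : n <= n ^+ 2 by rewrite expr2 ler_peMl// ltW.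
have h2 : (nedges e)%:R <= n ^+ 2 by rewrite -natrX ler_nat nedges_le.
lra.
Qed.

Lemma cost_le (ws : k.-tuple (seq V))
    (yss : (n_t R V).-tuple ((phase3_walks alpha e rule s ws).-tuple (seq V))) :
  0 <= cost (algorithm cap yss) <= cap + power_cost.
Proof.
have c0 := cap_gt0; have p0 : 0 <= power_cost by [].
rewrite /algorithm; case: ifP => /= [h|_]; last by rewrite lexx addr_ge0// ltW.
by rewrite ler0n/=; lra.
Qed.

(** When the cap is reached, the phases would cost at least [cap], itself at least c1 n ^ 2, whereas
    the Power Method costs at most 2 n ^ 2 per iteration. So switching multiplies the cost of the
    phases by a bounded factor per iteration. *)
Lemma cost_le_slowdown (ws : k.-tuple (seq V))
    (yss : (n_t R V).-tuple ((phase3_walks alpha e rule s ws).-tuple (seq V))) :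
  cost (algorithm cap yss) <= (1 + 2 * iters%:R / c1) *
    ((monte_carlo_cost ws + phase2_cost alpha e rule s ws)%:R + (phase3_cost yss)%:R).
Proof.
rewrite /algorithm -natrD.
set c := (_ + phase3_cost yss)%N.
have i0 : 0 <= 2 * iters%:R / c1 by rewrite divr_ge0 ?mulr_ge0 ?(ltW c1_gt0).
case: ltP => /= [_|capc]; first by rewrite ler_peMl// lerDl.
rewrite mulrDl mul1r lerD//; apply: le_trans power_cost_le _.
rewrite [leRHS]mulrAC ler_pdivlMr// -[leLHS]mulrA ler_wpM2l ?mulr_ge0// mulrC.
by apply: le_trans capc; case/andP: cap_bounds.
Qed.

Let walk0 := walk_pr_ge0 e alpha01 s.
Let walk1 := expect_walk_cst1 alpha01 dout_gt0 s.
Let iid0 (j : nat) := @iid_pr_ge0 _ _ _ walk0 j.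
Let iid1 (j : nat) := expect_iid_cst1 walk0 walk1 j.

Local Notation inner ws :=
  (expect (iid_pr (iid_pr (walk_pr alpha e s) (k := phase3_walks alpha e rule s ws))
     (k := n_t R V)) (fun yss => (cost (algorithm cap yss))%:E)).

Lemma inner_le_cap (ws : k.-tuple (seq V)) : (inner ws <= (cap + power_cost)%:E)%E.
Proof.
have j0 := iid_pr_ge0 (@iid0 (phase3_walks alpha e rule s ws)) (k := n_t R V).
have j1 := expect_iid_cst1 (@iid0 (phase3_walks alpha e rule s ws)) (iid1 _) (n_t R V).
have D0 : 0 <= cap + power_cost by rewrite addr_ge0// ltW// cap_gt0.
apply: le_trans (expect_cst_le j0 j1 D0); apply: le_expect => // yss.
by rewrite lee_fin; case/andP: (cost_le yss).
Qed.

Lemma expected_time_le_cap :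
  (expected_time alpha e rule s eps cap <= (cap + power_cost)%:E)%E.
Proof.
have D0 : 0 <= cap + power_cost by rewrite addr_ge0// ltW// cap_gt0.
apply: le_trans (expect_cst_le (@iid0 _) (iid1 _) D0); apply: le_expect => // ws.
exact: inner_le_cap.
Qed.

(** Once the walks of Phase I are fixed, only the cost of Phase III is still random. *)
Lemma inner_le_good (ws : k.-tuple (seq V)) : phase1_good alpha e s ws ->
  (inner ws <= ((1 + 2 * iters%:R / c1) * ((monte_carlo_cost ws)%:R +
     phase2_const alpha * ((halvings alpha e rule s ws).+1%:R * ((n_t R V)%:R * X)) +
     phase3_const alpha * ((n_t R V)%:R ^+ 2 * X)))%:E)%E.
Proof.
move=> good.
have j0 := iid_pr_ge0 (@iid0 (phase3_walks alpha e rule s ws)) (k := n_t R V).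
have j1 := expect_iid_cst1 (@iid0 (phase3_walks alpha e rule s ws)) (iid1 _) (n_t R V).
have i0 : 0 <= 1 + 2 * iters%:R / c1.
  by rewrite addr_ge0 ?divr_ge0 ?mulr_ge0 ?(ltW c1_gt0).
apply: (@le_trans _ _ (expect (iid_pr (iid_pr (walk_pr alpha e s)
    (k := phase3_walks alpha e rule s ws)) (k := n_t R V))
  (fun yss => (1 + 2 * iters%:R / c1)%:E *
    (cst (monte_carlo_cost ws + phase2_cost alpha e rule s ws)%:R%:E yss +
     (phase3_cost yss)%:R%:E))%E)).
  apply: le_expect => // yss; rewrite -EFinD -EFinM lee_fin.
  exact: cost_le_slowdown.
rewrite expectZ//; last by move=> yss; rewrite adde_ge0// lee_fin.
rewrite expectD//; try by move=> yss; rewrite lee_fin.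
rewrite EFinM lee_wpmul2l ?lee_fin// EFinD leeD//; last exact: expect_phase3_cost_le.
apply: le_trans (expect_cst_le j0 j1 (ler0n _ _)) _.
by rewrite lee_fin natrD lerD2l; exact: phase2_cost_le.
Qed.

(** * Moderate [eps]: logarithms of 1 / eps are O(log n) *)

Section ModerateEps.
Hypothesis eps_n : 1 < eps * n ^+ 3.

Lemma ln_inv_eps_le : ln eps^-1 <= 3 * ln n.
Proof.
have -> : 3 * ln n = ln (n ^+ 3) by rewrite lnXn// mulr_natl.
by rewrite ler_ln ?posrE ?invr_gt0 ?exprn_gt0// -div1r ler_pdivrMr// mulrC ltW.
Qed.

Lemma ln2_le1 : ln 2 <= 1 :> R.
Proof. by have -> : 2 = 1 + 1 :> R by []; apply: le_ln1Dx; lra. Qed.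

Lemma ln2_ge_half : 2^-1 <= ln 2 :> R.
Proof.
have : ln (1 + - 2^-1) <= - 2^-1 :> R by apply: le_ln1Dx; lra.
have -> : 1 + - 2^-1 = 2^-1 :> R by field.
by rewrite lnV ?posrE// lerN2.
Qed.

Lemma power_iters_le_log : iters%:R <= (3 * power_const + 1) * L.
Proof.
apply: le_trans power_iters_le _; have p0 := power_const_ge0.
have := ler_wpM2l p0 ln_inv_eps_le.
by have := ln_n_ge0; nra.
Qed.

(** The number is at most 18 (ln 2 + 2 ln n) + 1 <= 19 + 36 ln n. *)
Lemma n_t_le_log : (n_t R V)%:R <= 37 * L.
Proof.
apply: le_trans (natceil_le _) _.
  by rewrite mulr_ge0// ln_ge0//; have := exprn_ege1 2 n1; lra.
rewrite lnM ?posrE ?exprn_gt0// lnXn// -[ln n *+ 2]mulr_natl.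
by have := ln2_le1; have := ln_n_ge0; lra.
Qed.

Lemma phase1_walks_le_log : k%:R <= 37 * L / eps.
Proof.
have eV : 1 <= eps^-1 by rewrite invf_ge1 ?ltW.
apply: le_trans (natceil_le _) _.
  by rewrite divr_ge0 ?(ltW eps_gt0)// mulr_ge0// ln_2n3_ge0.
rewrite lnM ?posrE ?exprn_gt0// lnXn// -[ln n *+ 3]mulr_natl.
have l0 := ln_n_ge0; have l2 := ln2_le1.
have h : 12 * (ln 2 + 3 * ln n) + 1 <= 37 * L by lra.
apply: (@le_trans _ _ ((12 * (ln 2 + 3 * ln n) + 1) / eps)).
  by rewrite [leRHS]mulrDl mul1r lerD2l.
by rewrite ler_wpM2r// invr_ge0 ltW.
Qed.

(** From 2 ^ H <= 2 N0 <= 4 n ^ 4 and 1 / 2 <= ln 2 <= 1, one gets H <= 4 + 8 ln n. *)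
Lemma halvings_le_log (ws : k.-tuple (seq V)) :
  (halvings alpha e rule s ws).+1%:R <= 9 * L.
Proof.
have := halvings_pow_le rule s alpha01 dout_gt0 eps01 ws.
set H := halvings _ _ _ _ _; rewrite -(ler_nat R) natrX natrM => pow.
have eV : eps^-1 <= n ^+ 3 by rewrite -div1r ler_pdivrMr// mulrC ltW.
have nV : 1 <= n * n ^+ 3 by rewrite -exprS exprn_ege1.
have {}pow : 2 ^+ H <= 4 * n ^+ 4.
  apply: le_trans pow _; have -> : 4 * n ^+ 4 = 2 * (n * n ^+ 3 + n * n ^+ 3) by ring.
  rewrite ler_pM2l//; apply: le_trans (natceil_le _) _.
    by rewrite divr_ge0// ltW.
  by rewrite lerD// ler_pM2l.
have : ln (2 ^+ H) <= ln (4 * n ^+ 4) by rewrite ler_ln ?posrE ?mulr_gt0 ?exprn_gt0.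
have -> : 4 * n ^+ 4 = 2 ^+ 2 * n ^+ 4 by ring.
rewrite lnM ?posrE ?exprn_gt0// !lnXn// -!(mulr_natr (ln _)) -natr1.
have l0 := ln_n_ge0; have l1 := ln2_le1; have l2 := ln2_ge_half.
have := ler_wpM2r (ler0n R H) l2.
by clear pow eV nV; lra.
Qed.

Lemma expected_time_moderate :
  (expected_time alpha e rule s eps cap <= (phases_const * L ^+ 3 * X)%:E)%E.
Proof.
have L1 : 1 <= L by rewrite lerDl.
have L0 : 0 <= L by exact: le_trans L1.
have p0 := power_const_ge0.
have il := power_iters_le_log.
pose M := slowdown_const * L.
have M0 : 0 <= M by rewrite mulr_ge0// (le_trans _ slowdown_const_ge1).
have iM : 1 + 2 * iters%:R / c1 <= M.
  rewrite /M /slowdown_const [leRHS]mulrDl [1 * L]mul1r; apply: lerD => //.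
  rewrite [leRHS]mulrAC ler_wpM2r ?invr_ge0 ?(ltW c1_gt0)//.
  by rewrite -mulrA ler_pM2l.
pose D := (333 * phase2_const alpha + 1369 * phase3_const alpha) * (L ^+ 2 * X).
have P2 := phase2_const_ge0 alpha01; have P3 := phase3_const_ge0 alpha01.
have D0 : 0 <= D.
  apply: mulr_ge0; first by lra.
  by rewrite mulr_ge0 ?exprn_ge0// ltW.
have cp0 : 0 <= cap + power_cost by rewrite addr_ge0// ltW// cap_gt0.
have ntl := n_t_le_log.
have good_le (ws : k.-tuple (seq V)) : phase1_good alpha e s ws ->
    (inner ws <= (M * ((monte_carlo_cost ws)%:R + D))%:E)%E.
  move=> good; apply: le_trans (inner_le_good good) _; rewrite lee_fin.
  have Hl := halvings_le_log ws.
  set H := (halvings _ _ _ _ _).+1%:R in Hl *; set nt := (n_t R V)%:R in ntl *.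
  have H0 : 0 <= H by exact: ler0n.
  have nt0 : 0 <= nt by exact: ler0n.
  have X0 := ltW X_gt0.
  have h2 : H * (nt * X) <= 333 * (L ^+ 2 * X).
    have -> : 333 * (L ^+ 2 * X) = 9 * L * (37 * L * X) by ring.
    by apply: ler_pM => //; [exact: mulr_ge0|exact: ler_wpM2r].
  have h3 : nt ^+ 2 * X <= 1369 * (L ^+ 2 * X).
    have -> : 1369 * (L ^+ 2 * X) = (37 * L) ^+ 2 * X by ring.
    by rewrite ler_wpM2r// lerXn2r ?nnegrE ?mulr_ge0.
  apply: ler_pM => //.
  - by rewrite addr_ge0 ?divr_ge0 ?mulr_ge0 ?(ltW c1_gt0).
  - apply: addr_ge0; last by apply: mulr_ge0 => //; rewrite mulr_ge0 ?exprn_ge0.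
    apply: addr_ge0 => //; apply: mulr_ge0 => //; apply: mulr_ge0 => //.
    exact: mulr_ge0.
  rewrite -addrA lerD2l /D [leRHS]mulrDl; apply: lerD.
  - by rewrite [333 * _]mulrC -[leRHS]mulrA ler_wpM2l.
  - by rewrite [1369 * _]mulrC -[leRHS]mulrA ler_wpM2l.
(* Successful and failed first phases are merged into one pointwise bound, in which failure adds the
   capped cost times its indicator. *)
apply: (@le_trans _ _ (expect (iid_pr (walk_pr alpha e s) (k := k)) (fun ws =>
    M%:E * ((monte_carlo_cost ws)%:R%:E + cst D%:E ws) +
    (cap + power_cost)%:E * (~~ phase1_good alpha e s ws)%:R%:E)%E)).
  apply: le_expect => [|ws]; first exact: iid0.
  rewrite -EFinD; case: (boolP (phase1_good _ _ _ _)) => good /=.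
    by rewrite mulr0 addr0 good_le.
  apply: le_trans (inner_le_cap ws) _.
  by rewrite lee_fin mulr1 lerDr mulr_ge0// addr_ge0.
have iidk := @iid0 k.
have mc0 (ws : k.-tuple (seq V)) : (0 <= (monte_carlo_cost ws)%:R%:E + cst D%:E ws)%E.
  by rewrite -EFinD lee_fin addr_ge0.
rewrite expectD; last 3 first.
- exact: iidk.
- by move=> ws; apply: mule_ge0; [rewrite lee_fin|exact: mc0].
- by move=> ws; apply: mule_ge0; rewrite lee_fin.
rewrite !expectZ//.
rewrite expectD//.
have e1 : (expect (iid_pr (walk_pr alpha e s) (k := k))
    (fun ws => (monte_carlo_cost ws)%:R%:E) <= (k%:R * alpha^-1)%:E)%E.
  under eq_expect do rewrite /monte_carlo_cost natr_sum.
  apply: expect_iid_sum => //; first by rewrite invr_ge0 ltW.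
  exact: expect_walk_cost.
have e2 := expect_cst_le iidk (iid1 k) D0.
have e3 := expect_bad_le s alpha01 dout_gt0 eps_gt0.
apply: (@le_trans _ _ (M%:E * ((k%:R * alpha^-1)%:E + D%:E) +
    (cap + power_cost)%:E * (n ^- 2)%:E)%E).
  by rewrite leeD// lee_wpmul2l ?lee_fin// leeD.
rewrite -EFinD lee_fin.
have eX := time_bound_ge_inv s alpha01 dout_gt0 eps01.
have X1 := time_bound_ge1 s alpha01 dout_gt0 eps01.
have k_le : k%:R * alpha^-1 <= 37 / (alpha * weight_lb alpha) * (L ^+ 2 * X).
  have -> : 37 / (alpha * weight_lb alpha) * (L ^+ 2 * X) =
      37 * L * (L * (X / weight_lb alpha)) / alpha.
    by field; rewrite !gt_eqF.
  rewrite ler_wpM2r ?invr_ge0 ?(ltW alpha_gt0)//.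
  apply: le_trans phase1_walks_le_log _; rewrite ler_wpM2l ?mulr_ge0//.
  apply: le_trans eX _; by rewrite ler_peMl// divr_ge0 ?(ltW X_gt0) ?(ltW delta_gt0).
(* The capped cost is O(n ^ 2 L), and the failure probability cancels n ^ 2; the remaining O(L) is
   absorbed because X / [weight_lb] is at least 1. *)
have cp_le : (cap + power_cost) * n ^- 2 <=
    (`|c2| + 2 * (3 * power_const + 1)) * (L ^+ 3 * (X / weight_lb alpha)).
  rewrite ler_pdivrMr ?exprn_gt0//.
  apply: (@le_trans _ _ ((`|c2| + 2 * (3 * power_const + 1)) * L * n ^+ 2)).
    apply: le_trans (lerD cap_le power_cost_le) _.
    rewrite -mulrDl ler_wpM2r ?exprn_ge0// [leRHS]mulrDl; apply: lerD.
      by rewrite ler_peMr.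
    by rewrite -mulrA ler_pM2l.
  rewrite ler_wpM2r ?exprn_ge0// ler_wpM2l//.
    by have := normr_ge0 c2; lra.
  rewrite exprSr mulrAC mulrC ler_peMr// mulr_ege1//.
  by rewrite exprn_ege1.
rewrite /phases_const /fallback_const.
have Mk : M * (k%:R * alpha^-1 + D) <=
    M * (37 / (alpha * weight_lb alpha) * (L ^+ 2 * X) + D).
  by rewrite ler_wpM2l// lerD2r.
apply: le_trans (lerD Mk cp_le) _.
by rewrite /M /D le_eqVlt; apply/orP; left; apply/eqP; ring.
Qed.

End ModerateEps.

(* Here n^2 (1 + ln (1 / eps)) = O(1 / eps), so that the cap and the Power
   Method already meet the bound: with z the cube root of 1 / eps, one has n <= z and
   ln (1 / eps) <= 3 z. *)
Lemma expected_time_tiny : eps * n ^+ 3 <= 1 ->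
  (expected_time alpha e rule s eps cap <= (fallback_const * X)%:E)%E.
Proof.
move=> eps_n; apply: le_trans expected_time_le_cap _; rewrite lee_fin.
have p0 := power_const_ge0; have c0 := normr_ge0 c2.
have eV0 : 0 < eps^-1 by rewrite invr_gt0.
pose z := expR (ln eps^-1 / 3).
have z3 : z ^+ 3 = eps^-1.
  by rewrite /z -expRM_natr mulfVK// lnK ?posrE.
have lz : ln eps^-1 = 3 * ln z by rewrite expRK mulrC mulfVK.
have z0 : 0 < z by exact: expR_gt0.
have nz : n <= z.
  rewrite -(@ler_pXn2r _ 3) ?nnegrE ?(ltW z0)// z3.
  by rewrite -div1r ler_pdivlMr// mulrC.
have z1 : 1 <= z by exact: le_trans nz.
have lnz : ln z <= z by apply/ltW/ln_sublinear.
have n2 : n ^+ 2 <= z ^+ 2 by rewrite lerXn2r ?nnegrE ?(ltW z0).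
have iz : iters%:R <= (3 * power_const + 1) * z.
  apply: le_trans power_iters_le _; rewrite lz.
  by have := ler_wpM2l p0 lnz; lra.
apply: (@le_trans _ _ ((`|c2| + 2 * (3 * power_const + 1)) * eps^-1)); last first.
  rewrite /fallback_const mulrAC -mulrA ler_wpM2l//; first by lra.
  exact: time_bound_ge_inv.
rewrite -z3 [leRHS]mulrDl; apply: le_trans (lerD cap_le power_cost_le) _.
apply: lerD.
  rewrite ler_wpM2l//; apply: le_trans n2 _.
  by rewrite [z ^+ 3]exprS ler_peMl// exprn_ge0// ltW.
by rewrite -!mulrA ler_pM2l// exprS [leRHS]mulrA ler_pM.
Qed.

Lemma expected_time_le :
  (expected_time alpha e rule s eps cap <= (time_const * polylog R V 3 * X)%:E)%E.
Proof.
have L3 : 1 <= L ^+ 3 by rewrite exprn_ege1// lerDl.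
have C0 := phases_const_ge0; have T0 := fallback_const_ge0.
case: (leP (eps * n ^+ 3) 1) => h.
  apply: le_trans (expected_time_tiny h) _; rewrite lee_fin /polylog.
  rewrite ler_pM2r// (@le_trans _ _ time_const)//.
    by rewrite /time_const; lra.
  by rewrite ler_peMr// /time_const; lra.
apply: le_trans (expected_time_moderate h) _; rewrite lee_fin /polylog.
rewrite ler_pM2r// ler_wpM2r// ?exprn_ge0 ?addr_ge0//.
by rewrite /time_const; lra.
Qed.

Lemma time_bound_le_edges : X <= Num.sqrt (nedges e)%:R / eps.
Proof.
rewrite /time_bound mulrC ler_wpM2r ?invr_ge0 ?(ltW eps_gt0)// ler_wsqrtr//.
exact: push_weight_le.
Qed.

End ExpectedTime.

Theorem theorem10 (R : realType) (alpha c1 c2 : R) :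
  0 < alpha < 1 -> 0 < c1 ->
  exists (K : R) (k : nat),
  forall (V : finType) (e : rel V) (rule : push_rule R V)
         (s : V) (eps cap : R),
    (forall v : V, (0 < dout e v)%N) ->
    valid_rule alpha e rule ->
    0 < eps < 1 ->
    c1 * (nnodes V)%:R ^+ 2 <= cap <= c2 * (nnodes V)%:R ^+ 2 ->
    let softO (x : R) := K * polylog R V k * x in
    let bound := eps^-1 * Num.sqrt (push_weight alpha e s) in
    let edge_bound := Num.sqrt (nedges e)%:R / eps in
    [/\ (expected_time alpha e rule s eps cap <= (softO bound)%:E)%E,
        bound <= softO edge_bound
      & (expected_time alpha e rule s eps cap <= (softO edge_bound)%:E)%E].
Proof.
(* Two logarithms come from the phases, as [n_t] squared or [n_t] times the number of rounds, and
   the third from the Power Method overhead. *)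
move=> alpha01 c1_gt0; exists (time_const alpha c1 c2), 3%N.
move=> V e rule s eps cap dout_gt0 rule_valid eps01 cap_bounds softO bound edge_bound.
have K1 : 1 <= time_const alpha c1 c2.
  have := phases_const_ge0 c2 alpha01 c1_gt0; have := fallback_const_ge0 c2 alpha01.
  by rewrite /time_const; lra.
have L1 : 1 <= polylog R V 3.
  by rewrite exprn_ege1// lerDl ln_ge0// (nnodes_ge1 R s).
have KL1 : 1 <= time_const alpha c1 c2 * polylog R V 3 by exact: mulr_ege1.
have be : bound <= edge_bound := time_bound_le_edges alpha01 s dout_gt0 eps01.
have edge_ge0 : 0 <= edge_bound.
  by apply: le_trans be; rewrite ltW//; exact: time_bound_gt0.
have E := expected_time_le alpha01 c1_gt0 s dout_gt0 rule_valid eps01 cap_bounds.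
split; first exact: E.
- by apply: le_trans be _; rewrite ler_peMl.
- apply: le_trans E _; rewrite lee_fin ler_wpM2l//.
  exact: le_trans KL1.
Qed.
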